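(* Consider the test-time alignment setting and the algorithm VGB described in the context. Fix any prompt $x\in\mathcal X$ and $\delta>0$. Suppose that the exact outcome-level tilt is available, i.e. $\hat V(x,y_{1:H})=\tau(x,y_{1:H})$, and that for each $1\le h<H$ and each $y_{1:h}\in\mathcal A^h$, $$\frac{\hat V(x,y_{1:h})}{V^\star(x,y_{1:h})}\in\Big[\frac1{1+\varepsilon_V},\,1+\varepsilon_V\Big].$$ Let $\hat\pi$ be the output distribution (over nodes of the tree $\mathcal T$) of VGB run on prompt $x$ with step count $$T:=\tilde O\big(H^2\cdot(1+\varepsilon_V)^4\cdot\log(\delta^{-1})\big)$$ and returning its final node $y^{(T)}$, and let $\mathcal E_{\mathsf{leaf}}$ be the event that $y\sim\hat\pi$ is a leaf node. Then $$\Pr[\mathcal E_{\mathsf{leaf}}]\ \ge\ \frac{1}{8(1+\varepsilon_V)H}.$$ Moreover, $$D_{\mathsf{TV}}\big(\hat\pi|_{\mathcal E_{\mathsf{leaf}}},\,\pi^\star(\cdot\mid x)\big)\le\delta ,$$ where $\hat\pi|_{\mathcal E_{\mathsf{leaf}}}$ is $\hat\pi$ conditioned on $\mathcal E_{\mathsf{leaf}}$. The total runtime (including evaluations of $\hat V$ and queries to / conditional generations from $\pi_{\mathrm{ref}}$) is bounded by $O(|\mathcal A|\cdot T)$ in the small-action case and by $\tilde O(C_{\mathrm{act}}(x))\cdot T$ in the large-action case (the latter case requires approximate knowledge of $C_{\mathrm{act}}(x)$ and $1+\varepsilon_V$).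
   Context: Setting. $\mathcal A$ is a finite action set, $H\ge1$ an integer, $\mathcal X$ a prompt set, $\mathcal Y=\mathcal A^H$. The base model $\pi_{\mathrm{ref}}$ assigns to each $x\in\mathcal X$ a probability distribution $\pi_{\mathrm{ref}}(\cdot\mid x)$ on $\mathcal Y$; $\pi_{\mathrm{ref}}(y_h\mid x,y_{1:h-1})$ is the next-action conditional probability (same notation for other distributions on $\mathcal Y$). The tilt function is $\tau:\mathcal X\times\mathcal Y\to\mathbb R_{\ge0}$, and the true value function is $V^\star(x,y_{1:h})=\mathbb E_{y_{1:H}\sim\pi_{\mathrm{ref}}(\cdot\mid x)}[\tau(x,y_{1:H})\mid y_{1:h}]$. The target is $\pi^\star(y\mid x)\propto\pi_{\mathrm{ref}}(y\mid x)\tau(x,y)$ (the normalizing constant $\mathbb E_{\pi_{\mathrm{ref}}(\cdot\mid x)}[\tau(x,y)]$ is positive). An approximate value function is a map $\hat V$ giving a value $\hat V(x,y_{1:h})\ge0$ to each prompt and each prefix; $\varepsilon_V\ge0$ is a parameter. A ratio bound $\hat V/V^\star\in[1/\kappa,\kappa]$ is read as $V^\star/\kappa\le\hat V\le\kappa V^\star$. Action-level coverage coefficient: $C_{\mathrm{act}}(x):=\max_{h\in[H]}\max_{y_{1:h}}\pi^\star(y_h\mid x,y_{1:h-1})/\pi_{\mathrm{ref}}(y_h\mid x,y_{1:h-1})$. Tree. $\mathcal T$ is the rooted tree with node set $\bigcup_{h=0}^H\mathcal A^h$, root $\varnothing$, in which $y_{1:h-1}$ is the parent of $y_{1:h}$;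 leaves are the elements of $\mathcal A^H$. VGB. Start at $y^{(0)}=\varnothing$. For $t=0,\dots,T-1$: let $h=|y^{(t)}|$, and let $p^{(t)}$ be the probability distribution on the neighbours of $y^{(t)}=y^{(t)}_{1:h}$ in $\mathcal T$ with weights: parent $y^{(t)}_{1:h-1}$ (if $h>0$) gets weight $\hat V(x,y^{(t)}_{1:h})$; child $(y^{(t)}_{1:h},a)$, $a\in\mathcal A$ (if $h<H$), gets weight $\pi_{\mathrm{ref}}(a\mid x,y^{(t)}_{1:h})\hat V(x,(y^{(t)}_{1:h},a))$. With probability $1/2$ set $y^{(t+1)}=y^{(t)}$; otherwise draw $y^{(t+1)}\sim p^{(t)}$. Small-action case: $p^{(t)}$ is computed explicitly by enumerating $\mathcal A$ and sampled exactly. Large-action case: the draw from $p^{(t)}$ is replaced by a call to RejectionSampling$(g,q,M,\delta_{\mathsf{rej}})$ with $M=4C_{\mathrm{act}}(x)(1+\varepsilon_V)^2$ and $\delta_{\mathsf{rej}}=\delta/(16(1+\varepsilon_V)HT)$, where $q$ is the distribution on neighbours that (if $0<h<H$) gives the parent mass $1/2$ and child $(y^{(t)}_{1:h},a)$ mass $\frac12\pi_{\mathrm{ref}}(a\mid x,y^{(t)}_{1:h})$ (if $h=0$: child mass $\pi_{\mathrm{ref}}(a\mid x)$; if $h=H$: parent mass $1$), and $g$ maps the parent to $\hat V(x,y^{(t)}_{1:h})$ and child $(y^{(t)}_{1:h},a)$ to $\hat V(x,(y^{(t)}_{1:h},a))$. RejectionSampling$(g,q,M,\delta')$: let $N=4M\log(4/\delta')$;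 draw $z_1,\dots,z_N\sim q$ i.i.d. and set $\hat Z=\frac1N\sum_i g(z_i)$; then for up to $N$ rounds draw a fresh $z\sim q$ and return $z$ with probability $\min(g(z)/(\hat ZM),1)$; if no round returns, return a fresh $z\sim q$. $D_{\mathsf{TV}}$ is total variation distance; $\tilde O(\cdot)$ hides constants and logarithmic factors.
   Formalization: The large-action runtime carries an extra factor (1+ε_V)², since M=4C_act(1+ε_V)² makes the printed bound false for large ε_V; log(1/δ) in T is truncated below at 1, and the large-action leaf-probability bound is stated for δ≤1 (for δ≥1 the printed T is not positive). *)

(* Defs.v *)
From mathcomp Require Import all_boot all_order all_algebra.
From mathcomp Require Import reals exp.

Set Implicit Arguments.
Unset Strict Implicit.
Unset Printing Implicit Defensive.

Import Order.TTheory GRing.Theory Num.Theory.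
Local Open Scope ring_scope.

Definition natceil (R : realType) (x : R) : nat :=
  absz (Num.ceil (Num.max 0 x)).

(* The truncated logarithm max(1, log z); powers of it are the factors hidden
   by the soft-O notation. *)
Definition lg (R : realType) (z : R) : R := Num.max 1 (ln z).

Definition is_dist (R : realType) (T : finType) (p : T -> R) : Prop :=
  (forall t, 0 <= p t) /\ \sum_t p t = 1.

Definition dTV (R : realType) (T : finType) (p q : T -> R) : R :=
  2^-1 * \sum_t `|p t - q t|.

(* A response is an [H.-tuple A]; a node of the tree is a [seq A] of size at
   most [H], the root is [::], the parent of [rcons s a] is [s]. *)
Section Model.
Variables (R : realType) (A : finType) (H : nat).
Implicit Types (p tau : H.-tuple A -> R) (s : seq A) (a : A).

Definition pmass p s : R := \sum_(y : H.-tuple A | prefix s y) p y.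

(* Equal to 0 when [s] has mass 0, where the conditional is undefined. *)
Definition pnext p s a : R := pmass p (rcons s a) / pmass p s.

(* Only meaningful when [s] has positive mass. *)
Definition Vstar p tau s : R :=
  (\sum_(y : H.-tuple A | prefix s y) p y * tau y) / pmass p s.

Definition tilt p tau (y : H.-tuple A) : R :=
  p y * tau y / \sum_(z : H.-tuple A) p z * tau z.

(* The ratios are nonnegative and an undefined (0/0) ratio counts as 0, so it
   does not affect the maximum. *)
Definition Cact p tau : R :=
  \big[Num.max/0]_(h < H) \big[Num.max/0]_(s : h.-tuple A)
    \big[Num.max/0]_(a : A) (pnext (tilt p tau) s a / pnext p s a).

End Model.

(* Randomized programs for a fixed prompt.  The base model and the approximate
   value function are accessible only through oracle calls, so that every
   access is charged by [cost]. *)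
Inductive prog (R : realType) (A : finType) (B : Type) : Type :=
| Ret of B
| Tick of prog R A B                      (* one arithmetic operation *)
| EvalV of seq A & (R -> prog R A B)      (* value of a node *)
| QueryRef of seq A & A & (R -> prog R A B) (* next-action probability *)
| GenRef of seq A & (A -> prog R A B)     (* sample of the next action *)
| Bernoulli of R & (bool -> prog R A B)   (* coin with given bias *)
| Categorical of seq R & (nat -> prog R A B).
  (* index drawn with probability proportional to the listed weights *)

Arguments Ret {R A B}.
Arguments Tick {R A B}.
Arguments EvalV {R A B}.
Arguments QueryRef {R A B}.
Arguments GenRef {R A B}.
Arguments Bernoulli {R A B}.
Arguments Categorical {R A B}.

Fixpoint bind (R : realType) (A : finType) (B C : Type)
    (p : prog R A B) (f : B -> prog R A C) : prog R A C :=
  match p with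
  | Ret b => f b
  | Tick q => Tick (bind q f)
  | EvalV s k => EvalV s (fun v => bind (k v) f)
  | QueryRef s a k => QueryRef s a (fun v => bind (k v) f)
  | GenRef s k => GenRef s (fun a => bind (k a) f)
  | Bernoulli b k => Bernoulli b (fun c => bind (k c) f)
  | Categorical w k => Categorical w (fun i => bind (k i) f)
  end.

Section Semantics.
Variables (R : realType) (A : finType) (ref : seq A -> A -> R) (V : seq A -> R).

(* The expectation of [f] of the result of [p]. *)
Fixpoint expect (B : Type) (p : prog R A B) (f : B -> R) : R :=
  match p with
  | Ret b => f b
  | Tick q => expect q f
  | EvalV s k => expect (k (V s)) f
  | QueryRef s a k => expect (k (ref s a)) f
  | GenRef s k => \sum_(a : A) ref s a * expect (k a) f
  | Bernoulli b k => b * expect (k true) f + (1 - b) * expect (k false) f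
  | Categorical w k =>
      \sum_(i < size w) w`_i / (\sum_(j < size w) w`_j) * expect (k i) f
  end.

Definition Pr (B : Type) (p : prog R A B) (E : pred B) : R :=
  expect p (fun b => (E b)%:R).

(* Worst case over all random outcomes, in unit-cost operations. *)
Fixpoint cost (B : Type) (p : prog R A B) : nat :=
  match p with
  | Ret _ => 0
  | Tick q => (cost q).+1
  | EvalV s k => (cost (k (V s))).+1
  | QueryRef s a k => (cost (k (ref s a))).+1
  | GenRef _ k => (\max_(a : A) cost (k a)).+1
  | Bernoulli _ k => (maxn (cost (k true)) (cost (k false))).+1
  | Categorical w k => (size w + \max_(i < size w) cost (k i)).+1
  end.

End Semantics.

Section RejectionSampling.
Variables (R : realType) (A : finType) (Z : Type).
Variables (g : Z -> prog R A R) (q : prog R A Z).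

Fixpoint sum_draws (n : nat) : prog R A R :=
  if n is n'.+1 then
    bind q (fun z => bind (g z) (fun v =>
    bind (sum_draws n') (fun r => Tick (Ret (v + r)))))
  else Ret 0.

(* The acceptance probability is 0 when [Zhat = 0]. *)
Fixpoint rejection_rounds (Zhat M : R) (n : nat) : prog R A Z :=
  if n is n'.+1 then
    bind q (fun z => bind (g z) (fun v =>
    Tick (Tick (Tick (Bernoulli (Num.min (v / (Zhat * M)) 1)
      (fun accept => if accept then Ret z
                     else rejection_rounds Zhat M n'))))))
  else q.

Definition rejection_sampling (M delta' : R) : prog R A Z :=
  let N := natceil (4 * M * ln (4 / delta')) in
  bind (sum_draws N) (fun S =>
  Tick (rejection_rounds (S / N%:R) M N)).

End RejectionSampling.

Section VGB.
Variables (R : realType) (A : finType) (H : nat).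
Implicit Types (y z : seq A).

Definition parent y : seq A := take (size y).-1 y.

Fixpoint child_weights y (s : seq A) : prog R A (seq (seq A * R)) :=
  if s is a :: s' then
    QueryRef y a (fun pr => EvalV (rcons y a) (fun v =>
    Tick (bind (child_weights y s') (fun r => Ret ((rcons y a, pr * v) :: r)))))
  else Ret [::].

Definition parent_weight y : prog R A (seq (seq A * R)) :=
  if (0 < size y)%N then EvalV y (fun v => Ret [:: (parent y, v)])
  else Ret [::].

Definition neighbour_weights y : prog R A (seq (seq A * R)) :=
  bind (parent_weight y) (fun up =>
  bind (if (size y < H)%N then child_weights y (enum A) else Ret [::])
    (fun down => Ret (up ++ down))).

Definition step_small y : prog R A (seq A) :=
  bind (neighbour_weights y) (fun w =>
  Categorical (unzip2 w) (fun i => Ret (nth y (unzip1 w) i))).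

Definition child_draw y : prog R A (seq A) :=
  GenRef y (fun a => Ret (rcons y a)).

Definition proposal y : prog R A (seq A) :=
  if size y == 0%N then child_draw y
  else if (size y < H)%N then
    Bernoulli 2^-1 (fun up => if up then Ret (parent y) else child_draw y)
  else Ret (parent y).

(* The parent of [y] is the only neighbour shorter than [y], and its weight is
   the value of [y] itself. *)
Definition proposal_value y z : prog R A R :=
  if (size z < size y)%N then EvalV y Ret else EvalV z Ret.

Definition step_large (M delta' : R) y : prog R A (seq A) :=
  rejection_sampling (proposal_value y) (proposal y) M delta'.

Fixpoint lazy_walk (step : seq A -> prog R A (seq A)) (T : nat) y :
    prog R A (seq A) :=
  if T is T'.+1 then
    Bernoulli 2^-1 (fun stay =>
      if stay then lazy_walk step T' y
      else bind (step y) (lazy_walk step T'))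
  else Ret y.

Definition vgb_small (T : nat) : prog R A (seq A) :=
  lazy_walk step_small T [::].

Definition vgb_large (C epsV delta : R) (T : nat) : prog R A (seq A) :=
  lazy_walk (step_large (4 * C * (1 + epsV) ^+ 2)
                        (delta / (16 * (1 + epsV) * H%:R * T%:R))) T [::].

End VGB.

Definition is_leaf (A : finType) (H : nat) (y : seq A) : bool := size y == H.

(* The step count C * H^2 * (1 + epsV)^4 * log(1/delta), times the polylogarithmic
   factor log(H(1 + epsV))^k; logarithms are truncated below at 1. *)
Definition vgb_steps (R : realType) (C k H : nat) (epsV delta : R) : nat :=
  natceil (C%:R * H%:R ^+ 2 * (1 + epsV) ^+ 4 * lg delta^-1
           * lg (H%:R * (1 + epsV)) ^+ k).

(* The law of the output of [p] conditioned on its being a leaf. *)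
Definition leaf_law (R : realType) (A : finType) (H : nat)
    (ref : seq A -> A -> R) (V : seq A -> R) (p : prog R A (seq A))
    (y : H.-tuple A) : R :=
  Pr ref V p (pred1 (val y)) / Pr ref V p (is_leaf H).

(* Main.v *)
(* With [w s = pmass p s * V s] as the weight of the edge above the node [s], an
   exact step is the random walk on a weighted tree, reversible for the weighted
   degree, and on the leaves the weighted degree is proportional to the target.
   The flow [v s = sum of p * tau below s] is conserved and is within the factor
   [1 + epsV] of [w], so all the levels have comparable weight: the leaves carry
   a fraction at least [1 / (2 (1 + epsV) H)] of the stationary mass.  Comparing a
   function with its value at the root along paths gives a Poincare inequality
   with constant [2 (1 + epsV)^2 H^2], hence a contraction in L2, and the value at
   the root is read off the L2 norm because the root has large weight.

   Everything is phrased dually: the expectation of a test function, as a function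
   of the starting node, evolves by the kernel.  In the large-action case every
   step replaces the kernel by rejection sampling, whose error [3/2 delta'] comes
   from Chernoff bounds for the estimated normalization; the errors add up, and
   conditioning on a leaf divides the total by the leaf probability. *)

Require Import Defs.
From mathcomp Require Import all_boot all_order all_algebra.
From mathcomp Require Import sequences reals exp.
From mathcomp Require Import zify ring lra.

Set Implicit Arguments.
Unset Strict Implicit.
Unset Printing Implicit Defensive.

Import Order.TTheory GRing.Theory Num.Theory.
Local Open Scope ring_scope.

(** * The walk on a weighted tree *)

Lemma parent_rcons (A : finType) (s : seq A) a : parent (rcons s a) = s.
Proof. by rewrite /parent size_rcons -cats1 take_size_cat. Qed.

Section LevelSums.
Variables (R : realFieldType) (A : finType).
Implicit Types F G : seq A -> R.

Definition level h F : R := \sum_(s : h.-tuple A) F s.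

Lemma level0 F : level 0 F = F [::].
Proof.
rewrite /level (big_pred1 [tuple]) // => t.
by rewrite (tuple0 t) /= eqxx.
Qed.

Lemma levelS h F : level h.+1 F = level h (fun s => \sum_a F (rcons s a)).
Proof.
rewrite /level pair_big /=.
(* The tree grows by appending, so the bijection must split off the last letter of a tuple rather
   than the first. *)
pose unrcons (t : h.+1.-tuple A) : h.-tuple A * A :=
  ([tuple of belast (thead t) (behead t)], last (thead t) (behead t)).
rewrite (reindex (fun u : h.-tuple A * A => [tuple of rcons u.1 u.2])) //=.
exists unrcons => [[s a] _|t _]; last first.
  by apply: val_inj; rewrite /= -lastI [in RHS](tuple_eta t).
have E := congr1 val (tuple_eta [tuple of rcons s a]).
move: E; rewrite /= lastI => /rcons_inj [Es Ea].
by congr (_, _); [apply: val_inj | rewrite [RHS]Ea].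
Qed.

Lemma eq_level h F G :
  (forall s, size s = h -> F s = G s) -> level h F = level h G.
Proof. by move=> FG; apply: eq_bigr => s _; rewrite FG ?size_tuple. Qed.

Lemma ler_level h F G :
  (forall s, size s = h -> F s <= G s) -> level h F <= level h G.
Proof. by move=> FG; apply: ler_sum => s _; rewrite FG ?size_tuple. Qed.

Lemma levelD h F G : level h (fun s => F s + G s) = level h F + level h G.
Proof. exact: big_split. Qed.

Lemma levelZ h c F : level h (fun s => c * F s) = c * level h F.
Proof. by rewrite /level mulr_sumr. Qed.

Lemma level_ge0 h F : (forall s, size s = h -> 0 <= F s) -> 0 <= level h F.
Proof. by move=> F0; apply: sumr_ge0 => s _; rewrite F0 ?size_tuple. Qed.

End LevelSums.

(** Young's inequality: the difference of the two sides is the square of [g - r * d] divided by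
    [r]. *)
Lemma sqrD_le (R : realFieldType) (r g d : R) : 0 < r ->
  (g + d) ^+ 2 <= (1 + r^-1) * g ^+ 2 + (1 + r) * d ^+ 2.
Proof.
move=> r0; rewrite -subr_ge0.
have -> : (1 + r^-1) * g ^+ 2 + (1 + r) * d ^+ 2 - (g + d) ^+ 2
   = r^-1 * (g - r * d) ^+ 2 by field; rewrite gt_eqF.
by rewrite mulr_ge0 ?sqr_ge0 // invr_ge0 ltW.
Qed.

Section TreeWalk.
Variables (R : realFieldType) (A : finType) (H : nat).
Variables (w v : seq A -> R) (kap : R).
Hypothesis H_gt0 : (0 < H)%N.
Hypothesis kap_ge1 : 1 <= kap.
Hypothesis w_ge0 : forall s, (size s <= H)%N -> 0 <= w s.
Hypothesis v_ge0 : forall s, 0 <= v s.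
Hypothesis v_split : forall s, (size s < H)%N -> \sum_a v (rcons s a) = v s.
Hypothesis w_le : forall s, (0 < size s <= H)%N -> w s <= kap * v s.
Hypothesis v_le : forall s, (0 < size s <= H)%N -> v s <= kap * w s.
Implicit Types (F f : seq A -> R) (s : seq A).

Definition tsum F : R := \sum_(h < H.+1) level h F.
(** Edges are indexed by their lower endpoint, so this runs over all edges of the tree. *)
Definition esum F : R := \sum_(h < H) level h.+1 F.

(** The transition operator before normalization; the boolean factors remove the parent of the root
    and the children of a leaf. *)
Definition nbsum s F : R :=
  (0 < size s)%:R * (w s * F (parent s)) +
  (size s < H)%:R * \sum_a w (rcons s a) * F (rcons s a).

Definition deg s : R := nbsum s (fun=> 1).

Lemma eq_tsum F G :
  (forall s, (size s <= H)%N -> F s = G s) -> tsum F = tsum G.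
Proof.
move=> FG; apply: eq_bigr => h _; apply: eq_level => s sh.
by apply: FG; rewrite sh -ltnS.
Qed.

Lemma ler_tsum F G :
  (forall s, (size s <= H)%N -> F s <= G s) -> tsum F <= tsum G.
Proof.
move=> FG; apply: ler_sum => h _; apply: ler_level => s sh.
by apply: FG; rewrite sh -ltnS.
Qed.

Lemma tsumD F G : tsum (fun s => F s + G s) = tsum F + tsum G.
Proof. by rewrite -big_split; apply: eq_bigr => h _; apply: levelD. Qed.

Lemma tsumZ c F : tsum (fun s => c * F s) = c * tsum F.
Proof. by rewrite [RHS]mulr_sumr; apply: eq_bigr => h _; apply: levelZ. Qed.

Lemma tsum_ge0 F : (forall s, (size s <= H)%N -> 0 <= F s) -> 0 <= tsum F.
Proof.
move=> F0; apply: sumr_ge0 => h _; apply: level_ge0 => s sh.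
by apply: F0; rewrite sh -ltnS.
Qed.

Lemma tsum_ge_root F : (forall s, (size s <= H)%N -> 0 <= F s) ->
  F [::] <= tsum F.
Proof.
move=> F0; rewrite /tsum big_ord_recl level0 lerDl; apply: sumr_ge0 => h _.
by apply: level_ge0 => s sh; apply: F0; rewrite sh /= /bump.
Qed.

Lemma eq_esum F G :
  (forall s, (0 < size s <= H)%N -> F s = G s) -> esum F = esum G.
Proof.
move=> FG; apply: eq_bigr => h _; apply: eq_level => s sh.
by apply: FG; rewrite sh /=.
Qed.

Lemma ler_esum F G :
  (forall s, (0 < size s <= H)%N -> F s <= G s) -> esum F <= esum G.
Proof.
move=> FG; apply: ler_sum => h _; apply: ler_level => s sh.
by apply: FG; rewrite sh /=.
Qed.

Lemma esumD F G : esum (fun s => F s + G s) = esum F + esum G.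
Proof. by rewrite -big_split; apply: eq_bigr => h _; apply: levelD. Qed.

Lemma esumZ c F : esum (fun s => c * F s) = c * esum F.
Proof. by rewrite [RHS]mulr_sumr; apply: eq_bigr => h _; apply: levelZ. Qed.

Lemma nbsumD s F G : nbsum s (fun n => F n + G n) = nbsum s F + nbsum s G.
Proof.
rewrite /nbsum (eq_bigr _ (fun a _ => mulrDr (w (rcons s a)) _ _)) big_split /=.
by ring.
Qed.

Lemma nbsumZ s c F : nbsum s (fun n => c * F n) = c * nbsum s F.
Proof.
rewrite /nbsum (eq_bigr _ (fun a _ => mulrCA (w (rcons s a)) _ _)) -mulr_sumr /=.
by ring.
Qed.

Lemma nbsum_cst s c : nbsum s (fun=> c) = deg s * c.
Proof.
by rewrite /deg mulrC -nbsumZ /nbsum mulr1.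
Qed.

Lemma nbsum_ge0 s F : (size s <= H)%N -> (forall n, 0 <= F n) ->
  0 <= nbsum s F.
Proof.
move=> sH F0; rewrite /nbsum; apply: addr_ge0.
  by rewrite mulr_ge0 ?ler0n // mulr_ge0 // w_ge0.
case: ltnP => // sH'; rewrite ?mul0r // mul1r.
by apply: sumr_ge0 => a _; rewrite mulr_ge0 ?w_ge0 // size_rcons.
Qed.

Lemma deg_ge0 s : (size s <= H)%N -> 0 <= deg s.
Proof. by move=> sH; apply: nbsum_ge0. Qed.

(* Reversibility: each edge is counted once from either end. *)
Lemma tsum_nbsum (F : seq A -> seq A -> R) :
  tsum (fun s => nbsum s (F s)) =
  esum (fun s => w s * (F s (parent s) + F (parent s) s)).
Proof.
rewrite /nbsum tsumD.
have -> : esum (fun s => w s * (F s (parent s) + F (parent s) s)) =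
   esum (fun s => w s * F s (parent s)) + esum (fun s => w s * F (parent s) s).
  by rewrite -esumD; apply: eq_esum => s _; rewrite mulrDr.
congr (_ + _).
  rewrite /tsum big_ord_recl level0 /= mul0r add0r; apply: eq_bigr => h _.
  by apply: eq_level => s sh; rewrite sh /= mul1r.
rewrite /tsum big_ord_recr /= [X in _ + X](_ : _ = 0) ?addr0; last first.
  by apply: big1 => s _; rewrite size_tuple ltnn mul0r.
apply: eq_bigr => h _; rewrite levelS; apply: eq_level => s sh.
rewrite sh ltn_ord mul1r; apply: eq_bigr => a _.
by rewrite parent_rcons.
Qed.

Lemma tsum_deg F : tsum (fun s => deg s * F s) =
  esum (fun s => w s * (F s + F (parent s))).
Proof.
by rewrite -(tsum_nbsum (fun s _ => F s)); apply: eq_tsum => s _; rewrite nbsum_cst.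
Qed.

(** Conservation of the flow: the children of a node together carry its value of [v]. *)
Lemma level_v_parent h F : (h < H)%N ->
  level h.+1 (fun s => v s * F (parent s)) = level h (fun s => v s * F s).
Proof.
move=> hH; rewrite levelS; apply: eq_level => s sh.
rewrite -v_split ?sh // mulr_suml; apply: eq_bigr => a _.
by rewrite parent_rcons.
Qed.

(* Splitting [(g + d)^2 <= (1 + 1/h) g^2 + (1 + h) d^2] along the path from the
   root keeps the constant linear in the depth. *)
Lemma hardy f h : (h <= H)%N ->
  level h (fun s => v s * (f s - f [::]) ^+ 2) <=
  h%:R * \sum_(j < h) level j.+1 (fun s => v s * (f s - f (parent s)) ^+ 2).
Proof.
set D := fun j => level j (fun s => v s * (f s - f (parent s)) ^+ 2).
elim: h => [_|h IH hH]; first by rewrite level0 subrr expr0n /= mulr0 mul0r.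
have {}IH := IH (ltnW hH).
case: h hH IH => [|h] hH IH.
  rewrite mul1r big_ord_recl big_ord0 addr0 /= !levelS !level0.
  by apply: ler_sum => a _; rewrite parent_rcons.
set r := h.+1%:R : R.
have r0 : 0 < r by rewrite ltr0n.
have step : level h.+2 (fun s => v s * (f s - f [::]) ^+ 2) <=
    (1 + r^-1) * level h.+1 (fun s => v s * (f s - f [::]) ^+ 2)
    + (1 + r) * D h.+2.
  rewrite -(@level_v_parent h.+1 (fun s => (f s - f [::]) ^+ 2)) // /D -!levelZ -levelD.
  apply: ler_level => s _.
  rewrite !(mulrCA _ (v s)) -mulrDr ler_wpM2l //.
  have -> : f s - f [::] = (f (parent s) - f [::]) + (f s - f (parent s)) by ring.
  exact: sqrD_le.
apply: le_trans step _.
rewrite big_ord_recr /= -/(D h.+2) mulrDr.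
have -> : h.+2%:R = 1 + r :> R by rewrite -natr1 addrC.
(* Since [(1 + r^-1) * r = 1 + r], the old coefficient [r] grows exactly to the one required at the
   next depth. *)
rewrite lerD2r; apply: le_trans (ler_wpM2l _ IH) _.
  by rewrite addr_ge0 ?invr_ge0 // ltW.
rewrite mulrA -/r mulrDl mulVf ?gt_eqF // mul1r addrC.
by rewrite lexx.
Qed.

(** Passing from [w] to [v] and back costs [kap ^+ 2]; each edge is seen from its two endpoints,
    which gives the 2; one factor [H] comes from [hardy] and the other from summing over the
    levels. *)
Lemma poincare f : tsum (fun s => deg s * (f s - f [::]) ^+ 2) <=
  2 * kap ^+ 2 * H%:R ^+ 2 * esum (fun s => w s * (f s - f (parent s)) ^+ 2).
Proof.
have kap0 : 0 <= kap by apply: le_trans kap_ge1.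
set E := esum _.
set G := fun h => level h (fun s => v s * (f s - f [::]) ^+ 2).
set Ev := esum (fun s => v s * (f s - f (parent s)) ^+ 2).
have EvE : Ev <= kap * E.
  rewrite -esumZ; apply: ler_esum => s sH.
  by rewrite mulrA ler_wpM2r ?sqr_ge0 // v_le.
have Ev0 : 0 <= Ev.
  by apply: sumr_ge0 => h _; apply: level_ge0 => s _; rewrite mulr_ge0 ?sqr_ge0.
have GE h : (h <= H)%N -> G h <= H%:R * Ev.
  move=> hH; apply: le_trans (hardy f hH) _.
  apply: ler_pM; rewrite ?ler0n ?ler_nat //.
    by apply: sumr_ge0 => j _; apply: level_ge0 => s _; rewrite mulr_ge0 ?sqr_ge0.
  rewrite /Ev /esum (big_ord_widen H (fun j => level j.+1 _) hH).
  rewrite [leRHS](bigID (fun j : 'I_H => (j < h)%N)) /= lerDl.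
  by apply: sumr_ge0 => j _; apply: level_ge0 => s _; rewrite mulr_ge0 ?sqr_ge0.
rewrite tsum_deg.
have le1 : esum (fun s => w s * ((f s - f [::]) ^+ 2 + (f (parent s) - f [::]) ^+ 2))
   <= kap * (\sum_(h < H) (G h.+1 + G h)).
  rewrite mulr_sumr; apply: ler_sum => h _.
  rewrite /G -(@level_v_parent h (fun s => (f s - f [::]) ^+ 2)) // -levelD -levelZ.
  apply: ler_level => s sh; rewrite -mulrDr mulrA ler_wpM2r ?addr_ge0 ?sqr_ge0 //.
  by apply: w_le; rewrite sh /=.
apply: le_trans le1 _.
have le2 : \sum_(h < H) (G h.+1 + G h) <= H%:R * (2 * (H%:R * Ev)).
  have -> : H%:R * (2 * (H%:R * Ev)) = \sum_(h < H) 2 * (H%:R * Ev).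
    by rewrite sumr_const card_ord mulr_natl.
  apply: ler_sum => h _; rewrite mulr2n mulrDl mul1r lerD ?GE //.
  exact: ltnW.
apply: le_trans (ler_wpM2l kap0 le2) _.
have -> : 2 * kap ^+ 2 * H%:R ^+ 2 * E = kap * (H%:R * (2 * (H%:R * (kap * E)))) by ring.
by do !(rewrite ler_wpM2l ?ler0n //).
Qed.

(** * Contraction of the lazy walk in L2 *)

Section Kernel.
Variable K : (seq A -> R) -> seq A -> R.
(** Multiplying by the degree avoids a division at nodes of degree 0, where [K] may take any
    value. *)
Hypothesis degK : forall f s, (size s <= H)%N -> deg s * K f s = nbsum s f.

Definition lazy_step f s : R := 2^-1 * f s + 2^-1 * K f s.

(** Stationarity of [deg]: the edge sum given by reversibility is symmetric in the two endpoints. *)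
Lemma tsum_lazy_step f :
  tsum (fun s => deg s * lazy_step f s) = tsum (fun s => deg s * f s).
Proof.
have KE : tsum (fun s => deg s * K f s) = tsum (fun s => deg s * f s).
  rewrite (eq_tsum (@degK f)) (tsum_nbsum (fun _ => f)) tsum_deg.
  by apply: eq_esum => s _; rewrite addrC.
rewrite (@eq_tsum _ (fun s => 2^-1 * (deg s * f s) + 2^-1 * (deg s * K f s))).
  by rewrite tsumD !tsumZ KE; field.
by move=> s _; rewrite /lazy_step; ring.
Qed.

(** In the expansion of the square of [(f + K f) / 2], the term with [K f] squared is controlled by
    Jensen, and the cross term falls short of the second moment by the whole Dirichlet form. The
    cross term has coefficient [2^-1], hence the gain. *)
Lemma tsum_sqr_lazy_step f :
  tsum (fun s => deg s * lazy_step f s ^+ 2) <=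
  tsum (fun s => deg s * f s ^+ 2)
   - 2^-1 * esum (fun s => w s * (f s - f (parent s)) ^+ 2).
Proof.
set N := tsum (fun s => deg s * f s ^+ 2).
have jensen : tsum (fun s => deg s * K f s ^+ 2) <= N.
  have -> : N = tsum (fun s => nbsum s (fun n => f n ^+ 2)).
    rewrite (tsum_nbsum (fun _ n => f n ^+ 2)) /N tsum_deg.
    by apply: eq_esum => s _; rewrite addrC.
  apply: ler_tsum => s sH; rewrite -subr_ge0.
  (* The Jensen gap is a variance, a nonnegative combination of the squares [(f n - K f s) ^+ 2]. *)
  have -> : nbsum s (fun n => f n ^+ 2) - deg s * K f s ^+ 2 =
      nbsum s (fun n => (f n ^+ 2 + (- 2 * K f s) * f n) + K f s ^+ 2).
    rewrite nbsumD nbsumD nbsumZ nbsum_cst -(degK f) //; ring.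
  apply: nbsum_ge0 => // n; suff -> : f n ^+ 2 + - 2 * K f s * f n + K f s ^+ 2
     = (f n - K f s) ^+ 2 by apply: sqr_ge0.
  by ring.
have cross : tsum (fun s => deg s * (f s * K f s)) =
    N - esum (fun s => w s * (f s - f (parent s)) ^+ 2).
  have -> : tsum (fun s => deg s * (f s * K f s)) =
            tsum (fun s => nbsum s (fun n => f s * f n)).
    by apply: eq_tsum => s sH; rewrite nbsumZ -degK //; ring.
  rewrite (tsum_nbsum (fun s n => f s * f n)) /N tsum_deg.
  apply/eqP; rewrite eq_sym subr_eq -esumD; apply/eqP.
  by apply: eq_esum => s _; ring.
rewrite (@eq_tsum _ (fun s => 4^-1 * (deg s * f s ^+ 2) +
    2^-1 * (deg s * (f s * K f s)) + 4^-1 * (deg s * K f s ^+ 2))); last first.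
  by move=> s _; rewrite /lazy_step; field.
rewrite !tsumD !tsumZ cross -/N.
by move: jensen; set x := tsum _; set e := esum _ => jensen; lra.
Qed.

Lemma contract_ge0 : 0 <= 1 - (4 * kap ^+ 2 * H%:R ^+ 2)^-1 :> R.
Proof.
have e : 1 <= 4 * kap ^+ 2 * H%:R ^+ 2 :> R.
  by rewrite !mulr_ege1 ?exprn_ege1 ?ler1n.
by rewrite subr_ge0 invf_le1 // (lt_le_trans ltr01 e).
Qed.

(** For a function of mean zero, centring at the root instead of at the mean can only increase the
    second moment, so [poincare] bounds the second moment itself by the Dirichlet form. *)
Lemma lazy_step_contract f : tsum (fun s => deg s * f s) = 0 ->
  tsum (fun s => deg s * lazy_step f s ^+ 2) <=
  (1 - (4 * kap ^+ 2 * H%:R ^+ 2)^-1) * tsum (fun s => deg s * f s ^+ 2).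
Proof.
move=> f0; apply: le_trans (tsum_sqr_lazy_step f) _.
have H0 : 0 < H%:R :> R by rewrite ltr0n.
have kap0 : 0 < kap by apply: lt_le_trans kap_ge1.
set c := 2 * kap ^+ 2 * H%:R ^+ 2.
have c0 : 0 < c by rewrite !mulr_gt0 // exprn_gt0.
have -> : 4 * kap ^+ 2 * H%:R ^+ 2 = 2 * c by rewrite /c; ring.
have := poincare f; rewrite -/c; set E := esum _.
have -> : tsum (fun s => deg s * (f s - f [::]) ^+ 2) =
  tsum (fun s => deg s * f s ^+ 2) + f [::] ^+ 2 * tsum deg.
  rewrite (@eq_tsum _ (fun s => deg s * f s ^+ 2 +
     ((- 2 * f [::]) * (deg s * f s) + f [::] ^+ 2 * deg s))); last first.
    by move=> s _; ring.
  by rewrite tsumD [X in _ + X]tsumD !tsumZ f0 mulr0 add0r.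
set N := tsum (fun s => deg s * f s ^+ 2) => le.
have {}le : N <= c * E.
  apply: le_trans le; rewrite lerDl mulr_ge0 ?sqr_ge0 //.
  by apply: tsum_ge0 => s sH; apply: deg_ge0.
rewrite mulrBl mul1r lerD2l lerN2 invfM -mulrA ler_wpM2l ?invr_ge0 //.
by rewrite mulrC ler_pdivrMr // mulrC.
Qed.

Fixpoint lazy_iter t f : seq A -> R :=
  if t is t'.+1 then lazy_step (lazy_iter t' f) else f.

Lemma tsum_lazy_iter t f :
  tsum (fun s => deg s * lazy_iter t f s) = tsum (fun s => deg s * f s).
Proof. by elim: t => //= t IH; rewrite tsum_lazy_step. Qed.

Lemma lazy_iter_contract t f : tsum (fun s => deg s * f s) = 0 ->
  tsum (fun s => deg s * lazy_iter t f s ^+ 2) <=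
  (1 - (4 * kap ^+ 2 * H%:R ^+ 2)^-1) ^+ t * tsum (fun s => deg s * f s ^+ 2).
Proof.
move=> f0; elim: t => [|t IH] /=; first by rewrite expr0 mul1r.
apply: le_trans (lazy_step_contract _) _; first by rewrite tsum_lazy_iter.
by rewrite [_ ^+ t.+1]exprS -[leRHS]mulrA ler_wpM2l // contract_ge0.
Qed.

Lemma level_v h : (h <= H)%N -> level h v = v [::].
Proof.
elim: h => [_|h IH hH]; first by rewrite level0.
rewrite -IH ?(ltnW hH) // levelS; apply: eq_level => s sh.
by rewrite v_split // sh.
Qed.

Lemma level_w_le h : (0 < h <= H)%N -> level h w <= kap * v [::].
Proof.
move=> hH; rewrite -(@level_v h); last by case/andP: hH.
by rewrite -levelZ; apply: ler_level => s sh; apply: w_le; rewrite sh.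
Qed.

Lemma tsum_deg1 : tsum deg = 2 * esum w.
Proof.
have := tsum_deg (fun=> 1); rewrite -esumZ => E.
rewrite (@eq_tsum _ (fun s => deg s * 1)) => [|s _]; last by rewrite mulr1.
by rewrite E; apply: eq_esum => s _; ring.
Qed.

Lemma tsum_deg_le : tsum deg <= 2 * kap * H%:R * v [::].
Proof.
have -> : 2 * kap * H%:R * v [::] = 2 * \sum_(h < H) kap * v [::].
  by rewrite sumr_const card_ord -mulr_natl; ring.
rewrite tsum_deg1 ler_wpM2l // ler_sum // => h _.
by apply: level_w_le; rewrite ltn_ord.
Qed.

Lemma deg_leaf s : size s = H -> deg s = w s.
Proof. by move=> sH; rewrite /deg /nbsum sH ltnn H_gt0 mul1r mul0r addr0 mulr1. Qed.

(** At an inner node the edges to the children already carry the flow up to the factor [kap]; at a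
    leaf the edge to the parent does. *)
Lemma deg_ge s : (size s <= H)%N -> v s <= kap * deg s.
Proof.
rewrite leq_eqVlt => /predU1P[sH|sH].
  by rewrite deg_leaf //; apply: v_le; rewrite sH H_gt0 leqnn.
apply: le_trans (_ : kap * \sum_a w (rcons s a) <= _).
  rewrite -v_split // mulr_sumr; apply: ler_sum => a _; apply: v_le.
  by rewrite size_rcons.
rewrite ler_wpM2l ?(le_trans ler01) // /deg /nbsum sH mul1r mulr1.
rewrite (eq_bigr _ (fun a _ => mulr1 (w (rcons s a)))) lerDr.
by rewrite mulr_ge0 // w_ge0 // ltnW.
Qed.

(** The bound on [F] is asked only across edges of positive weight, so that nodes the walk cannot
    reach may be ignored later. *)
Lemma norm_nbsum_le s F B : (size s <= H)%N ->
  ((0 < size s)%N -> 0 < w s -> `|F (parent s)| <= B) ->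
  (forall a, (size s < H)%N -> 0 < w (rcons s a) -> `|F (rcons s a)| <= B) ->
  `|nbsum s F| <= deg s * B.
Proof.
move=> sH Fp Fc; rewrite -nbsum_cst /nbsum.
apply: le_trans (ler_normD _ _) _; rewrite !normrM !normr_nat.
apply: lerD.
  case: (posnP (size s)) => [_|s0]; rewrite ?mul0r // !mul1r.
  have := w_ge0 sH; rewrite le_eqVlt => /predU1P[<-|ws]; first by rewrite normr0 !mul0r.
  by rewrite gtr0_norm // ler_wpM2l ?(ltW ws) // Fp.
case: (ltnP (size s) H) => [sH'|_]; rewrite ?mul0r // !mul1r.
apply: le_trans (ler_norm_sum _ _ _) _; apply: ler_sum => a _.
have wa : 0 <= w (rcons s a) by rewrite w_ge0 // size_rcons.
have := wa; rewrite normrM ger0_norm // le_eqVlt => /predU1P[<-|ws].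
  by rewrite !mul0r.
by rewrite ler_wpM2l // Fc.
Qed.

Lemma tsum_leaf F : (forall s, (size s < H)%N -> F s = 0) -> tsum F = level H F.
Proof.
move=> F0; rewrite /tsum big_ord_recr big1 /= ?add0r // => h _.
by apply: big1 => s _; rewrite F0 ?size_tuple.
Qed.

(** The root contributes one term to the L2 norm, and [deg [::]] is at least the total degree
    divided by [2 * kap ^+ 2 * H%:R], which gives the last factor. *)
Lemma lazy_iter_root t f b : 0 < v [::] ->
  tsum (fun s => deg s * f s) = 0 ->
  (forall s, (size s <= H)%N -> `|f s| <= b) ->
  lazy_iter t f [::] ^+ 2 <=
  (1 - (4 * kap ^+ 2 * H%:R ^+ 2)^-1) ^+ t * (2 * kap ^+ 2 * H%:R * b ^+ 2).
Proof.
move=> v0 f0 fb.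
have kap0 : 0 < kap by apply: lt_le_trans kap_ge1.
have d0 : 0 < deg [::].
  by rewrite -(pmulr_rgt0 _ kap0); apply: lt_le_trans v0 (deg_ge _).
rewrite -(ler_pM2l d0).
apply: le_trans (tsum_ge_root (F := fun s => deg s * lazy_iter t f s ^+ 2) _) _.
  by move=> s sH; rewrite mulr_ge0 ?sqr_ge0 ?deg_ge0.
apply: le_trans (lazy_iter_contract t f0) _.
rewrite [leRHS]mulrCA ler_wpM2l //.
  by rewrite exprn_ge0 // contract_ge0.
have b0 : 0 <= b by apply: le_trans (fb [::] _).
apply: (@le_trans _ _ (b ^+ 2 * tsum deg)).
  rewrite -tsumZ; apply: ler_tsum => s sH; rewrite mulrC ler_wpM2r ?deg_ge0 //.
  by rewrite -[f s ^+ 2]real_normK ?num_real // lerXn2r ?nnegrE ?fb.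
have -> : deg [::] * (2 * kap ^+ 2 * H%:R * b ^+ 2) =
   b ^+ 2 * (2 * kap * H%:R * (kap * deg [::])) by ring.
rewrite ler_wpM2l ?sqr_ge0 //; apply: le_trans tsum_deg_le _.
by rewrite ler_wpM2l ?deg_ge // !mulr_ge0 ?ler0n // ltW.
Qed.

End Kernel.
End TreeWalk.

(** * Randomized programs and rejection sampling *)

Section RealBounds.
Variable R : realType.
Implicit Types x : R.

Lemma natceil_ge x : x <= (natceil x)%:R.
Proof.
rewrite /natceil natr_absz ger0_norm ?le_ceil ?ceil_ge0 ?(lt_le_trans (ltrN10 R)) ?le_max ?lexx //.
by apply: le_trans (ceil_ge _); rewrite le_max lexx orbT.
Qed.

Lemma natceil_le x : (natceil x)%:R <= Num.max 0 x + 1.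
Proof.
rewrite /natceil natr_absz ger0_norm ?ceil_ge0 ?(lt_le_trans (ltrN10 R)) ?le_max ?lexx //.
by have := ceilB1_lt (Num.max 0 x); rewrite intrB => /ltW; rewrite lerBlDr.
Qed.

(** From [expR x <= (1 - x)^-1], since [(1 - x) * (1 + 2 * x) >= 1] on this interval. *)
Lemma expR_le_Dx x : 0 <= x <= 2^-1 -> expR x <= 1 + 2 * x.
Proof.
move=> /andP[x0 x2]; have := expR_ge1Dx (- x).
rewrite expRN => le; have e0 := expR_gt0 x.
have : (1 - x) * expR x <= 1 by rewrite -ler_pdivlMr // div1r.
set e := expR x in e0 le * => h.
have : (1 - x) * (e - (1 + 2 * x)) <= 0 by nra.
by rewrite pmulr_rle0 ?subr_le0 //; lra.
Qed.

(** The bound [1 + x <= expR x] alone is too weak near [x = 2^-1]; used at [x / 4] and raised to the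
    fourth power, it suffices. The slope 3/4 leaves a margin over 1/2 for the lower tail of the
    draws. *)
Lemma expRN_le_Bx x : 0 <= x <= 2^-1 -> expR (- x) <= 1 - 3 / 4 * x.
Proof.
move=> /andP[x0 x2]; rewrite expRN -div1r ler_pdivrMr ?expR_gt0 //.
have e4 : (1 + x / 4) ^+ 4 <= expR x.
  have -> : expR x = expR (x / 4) ^+ 4.
    by rewrite -expRM_natl; congr expR; field.
  by rewrite lerXn2r ?nnegrE ?expR_ge0 ?expR_ge1Dx // addr_ge0 // divr_ge0.
apply: le_trans (ler_wpM2l _ e4); last by lra.
have x2' : 0 <= x ^+ 2 <= 4^-1 by rewrite sqr_ge0; nra.
have x3' : 0 <= x ^+ 3 <= 8^-1 by rewrite exprn_ge0 //= exprS; nra.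
have x4' : 0 <= x ^+ 4 <= 16^-1 by rewrite exprn_ge0 //= exprS; nra.
rewrite -subr_ge0.
have -> : (1 - 3 / 4 * x) * (1 + x / 4) ^+ 4 - 1 =
  x * (4^-1 - 3 / 8 * x - 7 / 32 * x ^+ 2 - 11 / 256 * x ^+ 3 - 3 / 1024 * x ^+ 4).
  by field.
by rewrite mulr_ge0 //; lra.
Qed.

End RealBounds.

Section Programs.
Variables (R : realType) (A : finType) (ref : seq A -> A -> R) (V : seq A -> R).
Local Notation expect := (expect ref V).

Lemma expect_bind B C (p : prog R A B) (f : B -> prog R A C) (phi : C -> R) :
  expect (bind p f) phi = expect p (fun b => expect (f b) phi).
Proof.
elim: p => //= [s k IH|b k IH|ws k IH].
- by apply: eq_bigr => a _; rewrite IH.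
- by rewrite !IH.
- by apply: eq_bigr => i _; rewrite IH.
Qed.

Lemma eq_expect B (p : prog R A B) (phi psi : B -> R) :
  phi =1 psi -> expect p phi = expect p psi.
Proof.
move=> E; elim: p => //= [s k IH|b k IH|ws k IH].
- by apply: eq_bigr => a _; rewrite IH.
- by rewrite !IH.
- by apply: eq_bigr => i _; rewrite IH.
Qed.

(** Linearity holds for arbitrary weights; positivity and normalization depend on the oracles and
    are established separately. *)
Lemma expectD B (p : prog R A B) (phi psi : B -> R) :
  expect p (fun b => phi b + psi b) = expect p phi + expect p psi.
Proof.
elim: p => //= [s k IH|b k IH|ws k IH].
- by rewrite -big_split; apply: eq_bigr => a _; rewrite IH mulrDr.
- by rewrite !IH; ring.
- by rewrite -big_split; apply: eq_bigr => i _; rewrite IH mulrDr.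
Qed.

Lemma expectZ B (p : prog R A B) c (phi : B -> R) :
  expect p (fun b => c * phi b) = c * expect p phi.
Proof.
elim: p => //= [s k IH|b k IH|ws k IH].
- by rewrite mulr_sumr; apply: eq_bigr => a _; rewrite IH mulrCA.
- by rewrite !IH; ring.
- by rewrite mulr_sumr; apply: eq_bigr => i _; rewrite IH mulrCA.
Qed.

Lemma expect_sum B (p : prog R A B) (I : finType) (phi : I -> B -> R) :
  expect p (fun b => \sum_i phi i b) = \sum_i expect p (phi i).
Proof.
elim: p => //= [s k IH|b k IH|ws k IH].
- rewrite exchange_big; apply: eq_bigr => a _.
  by rewrite IH mulr_sumr.
- by rewrite !IH !mulr_sumr -big_split.
- rewrite exchange_big; apply: eq_bigr => i _.
  by rewrite IH mulr_sumr.
Qed.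

Lemma cost_bind_le B C (p : prog R A B) (f : B -> prog R A C) n :
  (forall b, cost ref V (f b) <= n)%N ->
  (cost ref V (bind p f) <= cost ref V p + n)%N.
Proof.
move=> fn; elim: p => //= [s k IH|s a k IH|s k IH|b k IH|ws k IH].
- exact: IH.
- exact: IH.
- rewrite addSn ltnS; apply/bigmax_leqP => a _; apply: leq_trans (IH a) _.
  by rewrite leq_add2r (leq_bigmax a).
- by rewrite addSn ltnS geq_max !(leq_trans (IH _)) // leq_add2r leq_max leqnn ?orbT.
- rewrite addSn ltnS -addnA leq_add2l; apply/bigmax_leqP => i _.
  by apply: leq_trans (IH i) _; rewrite leq_add2r (leq_bigmax i).
Qed.

End Programs.

(** * Error of rejection sampling *)

Section Rejection.
Variables (R : realType) (A : finType) (ref : seq A -> A -> R) (V : seq A -> R).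
Variables (Z : Type) (gp : Z -> prog R A R) (prop : prog R A Z).
Variables (I : finType) (q : I -> R) (pt : I -> Z) (g : Z -> R).
Local Notation expect := (expect ref V).
Hypothesis expect_prop : forall phi, expect prop phi = \sum_i q i * phi (pt i).
Hypothesis expect_gp : forall z phi, expect (gp z) phi = phi (g z).
Hypothesis q_ge0 : forall i, 0 <= q i.
(** Mass below 1 is allowed because conditionals at a node of mass zero are all 0; exact
    normalization is assumed only for the accuracy bound. *)
Hypothesis q_le1 : \sum_i q i <= 1.
Hypothesis g_ge0 : forall i, 0 <= g (pt i).

Lemma expect_sum_drawsS N psi : expect (sum_draws gp prop N.+1) psi =
  \sum_i q i * expect (sum_draws gp prop N) (fun r => psi (g (pt i) + r)).
Proof.
rewrite /= expect_bind expect_prop; apply: eq_bigr => i _.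
by rewrite expect_bind expect_gp expect_bind.
Qed.

Lemma ler_expect_sum_draws N psi1 psi2 :
  (forall S, 0 <= S -> psi1 S <= psi2 S) ->
  expect (sum_draws gp prop N) psi1 <= expect (sum_draws gp prop N) psi2.
Proof.
elim: N psi1 psi2 => [|N IH] psi1 psi2 le12; first exact: le12.
rewrite !expect_sum_drawsS; apply: ler_sum => i _; rewrite ler_wpM2l //.
by apply: IH => S S0; apply: le12; rewrite addr_ge0.
Qed.

(** The moment generating function factors over independent draws; it feeds the Chernoff bounds. *)
Lemma expect_sum_draws_exp N c :
  expect (sum_draws gp prop N) (fun S => expR (c * S)) =
  (\sum_i q i * expR (c * g (pt i))) ^+ N.
Proof.
elim: N => [|N IH]; first by rewrite /= mulr0 expR0 expr0.
rewrite expect_sum_drawsS exprS mulr_suml; apply: eq_bigr => i _.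
rewrite -mulrA; congr (_ * _); rewrite -IH -expectZ; apply: eq_expect => S.
by rewrite mulrDr expRD.
Qed.

Lemma expect_sum_draws_cst N c : expect (sum_draws gp prop N) (fun=> c) =
  (\sum_i q i) ^+ N * c.
Proof.
elim: N => [|N IH]; first by rewrite /= expr0 mul1r.
by rewrite expect_sum_drawsS -mulr_suml IH exprS mulrA.
Qed.

Definition accept (Zhat M : R) i : R := Num.min (g (pt i) / (Zhat * M)) 1.

Lemma accept_itv Zhat M i : 0 <= Zhat -> 0 <= M -> 0 <= accept Zhat M i <= 1.
Proof.
move=> Z0 M0; rewrite /accept ge_min lexx orbT andbT le_min ler01 andbT.
by rewrite divr_ge0 // mulr_ge0.
Qed.

Lemma expect_rejection_roundsS Zhat M n phi :
  expect (rejection_rounds gp prop Zhat M n.+1) phi =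
  \sum_i q i * (accept Zhat M i * phi (pt i) +
    (1 - accept Zhat M i) * expect (rejection_rounds gp prop Zhat M n) phi).
Proof.
rewrite /= expect_bind expect_prop; apply: eq_bigr => i _.
by rewrite expect_bind expect_gp.
Qed.

Lemma rejection_rounds_ge0 Zhat M n phi : 0 <= Zhat -> 0 <= M ->
  (forall i, 0 <= phi (pt i)) ->
  0 <= expect (rejection_rounds gp prop Zhat M n) phi.
Proof.
move=> Z0 M0 phi0; elim: n => [|n IH].
  by rewrite /= expect_prop; apply: sumr_ge0 => i _; rewrite mulr_ge0.
rewrite expect_rejection_roundsS; apply: sumr_ge0 => i _.
have /andP[b0 b1] := accept_itv i Z0 M0.
by rewrite mulr_ge0 // addr_ge0 // mulr_ge0 // subr_ge0.
Qed.

Lemma rejection_rounds_le Zhat M n phi B : 0 <= Zhat -> 0 <= M -> 0 <= B ->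
  (forall i, phi (pt i) <= B) ->
  expect (rejection_rounds gp prop Zhat M n) phi <= B.
Proof.
move=> Z0 M0 B0 phiB.
have qB : \sum_i q i * B <= B by rewrite -mulr_suml ler_piMl.
elim: n => [|n IH]; apply: le_trans qB.
  by rewrite /= expect_prop; apply: ler_sum => i _; rewrite ler_wpM2l.
rewrite expect_rejection_roundsS; apply: ler_sum => i _; rewrite ler_wpM2l //.
have /andP[b0 b1] := accept_itv i Z0 M0.
rewrite [leRHS](_ : B = accept Zhat M i * B + (1 - accept Zhat M i) * B); last by ring.
by rewrite lerD // ler_wpM2l // subr_ge0.
Qed.

Lemma rejection_rounds_norm Zhat M n phi B : 0 <= Zhat -> 0 <= M ->
  (forall i, `|phi (pt i)| <= B) -> 0 <= B ->
  `|expect (rejection_rounds gp prop Zhat M n) phi| <= B.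
Proof.
move=> Z0 M0 phiB B0; rewrite ler_norml; apply/andP; split; last first.
  apply: rejection_rounds_le => // i; exact: le_trans (ler_norm _) (phiB i).
rewrite lerNl -mulN1r -expectZ; apply: rejection_rounds_le => // i.
by rewrite mulN1r; apply: le_trans (phiB i); rewrite -normrN ler_norm.
Qed.

Lemma rejection_sampling_ge0 M delta' phi : 0 <= M ->
  (forall i, 0 <= phi (pt i)) ->
  0 <= expect (rejection_sampling gp prop M delta') phi.
Proof.
move=> M0 phi0; rewrite /rejection_sampling expect_bind.
rewrite -[0](mulr0 ((\sum_i q i) ^+ natceil (4 * M * ln (4 / delta')))).
rewrite -expect_sum_draws_cst; apply: ler_expect_sum_draws => S S0 /=.
by apply: rejection_rounds_ge0; rewrite ?divr_ge0.
Qed.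

Lemma rejection_sampling_norm M delta' phi B : 0 <= M ->
  (forall i, `|phi (pt i)| <= B) -> 0 <= B ->
  `|expect (rejection_sampling gp prop M delta') phi| <= B.
Proof.
move=> M0 phiB B0; rewrite /rejection_sampling expect_bind.
set N := natceil _.
have qB : (\sum_i q i) ^+ N * B <= B.
  by rewrite ler_piMl // exprn_ile1 // sumr_ge0.
have bnd S : 0 <= S -> `|expect (rejection_rounds gp prop (S / N%:R) M N) phi| <= B.
  by move=> S0; apply: rejection_rounds_norm; rewrite ?divr_ge0.
rewrite ler_norml lerNl; apply/andP; split; apply: le_trans qB.
  rewrite -mulN1r -expectZ -expect_sum_draws_cst; apply: ler_expect_sum_draws => S S0 /=.
  by rewrite mulN1r; apply: le_trans (bnd S S0); rewrite -normrN ler_norm.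
rewrite -expect_sum_draws_cst; apply: ler_expect_sum_draws => S S0 /=.
exact: le_trans (ler_norm _) (bnd S S0).
Qed.

Section Accuracy.
Variables (M : R).
Hypothesis q_sum1 : \sum_i q i = 1.
Let Zq : R := \sum_i q i * g (pt i).
Hypothesis Zq_gt0 : 0 < Zq.
Hypothesis g_le : forall i, 0 < q i -> g (pt i) <= M / 2 * Zq.

(** The mean of [g] is at most the upper bound of [g] on the support of [q]. *)
Let M_ge2 : 2 <= M.
Proof.
have : Zq <= M / 2 * Zq.
  have -> : M / 2 * Zq = \sum_i q i * (M / 2 * Zq) by rewrite -mulr_suml q_sum1 mul1r.
  apply: ler_sum => i _; have := q_ge0 i.
  rewrite le_eqVlt => /predU1P[<-|qi]; first by rewrite !mul0r.
  by rewrite ler_wpM2l ?q_ge0 // g_le.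
by rewrite -[leLHS]mul1r ler_pM2r // ler_pdivlMr // mul1r.
Qed.

Let M_gt0 : 0 < M. Proof. exact: lt_le_trans M_ge2. Qed.

(* A failed round leaves the law of the output unchanged, so each round shrinks
   the error by the probability of failure. *)
Lemma rejection_rounds_error Zhat n phi : Zq / 2 <= Zhat ->
  expect (rejection_rounds gp prop Zhat M n) phi
    - (\sum_i q i * (g (pt i) * phi (pt i))) / Zq =
  (1 - Zq / (Zhat * M)) ^+ n *
   ((\sum_i q i * phi (pt i)) - (\sum_i q i * (g (pt i) * phi (pt i))) / Zq).
Proof.
move=> Zh; have Zh0 : 0 < Zhat by apply: lt_le_trans Zh; rewrite divr_gt0.
(* The truncation at 1 never acts on the support of [q]: there [g] is at most [M * (Zq / 2)], hence
   at most [Zhat * M]. *)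
have qa i : q i * accept Zhat M i = q i * (g (pt i) / (Zhat * M)).
  have := q_ge0 i; rewrite le_eqVlt => /predU1P[<-|qi]; first by rewrite !mul0r.
  congr (_ * _); rewrite /accept min_l // ler_pdivrMr ?mulr_gt0 // mul1r.
  apply: le_trans (g_le qi) _.
  by rewrite mulrAC -mulrA mulrC ler_pM2r.
elim: n => [|n IH]; first by rewrite /= expect_prop expr0 mul1r.
rewrite exprS -mulrA -IH expect_rejection_roundsS.
set r := expect _ _; set X := \sum_i q i * (_ * _).
have -> : \sum_i q i * (accept Zhat M i * phi (pt i) + (1 - accept Zhat M i) * r)
   = (Zhat * M)^-1 * X + r - Zq / (Zhat * M) * r.
  transitivity (\sum_i ((Zhat * M)^-1 * (q i * (g (pt i) * phi (pt i))) + q i * r +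
      - (Zhat * M)^-1 * r * (q i * g (pt i)))).
    apply: eq_bigr => i _.
    rewrite [LHS](_ : _ = q i * accept Zhat M i * phi (pt i) + q i * r -
       q i * accept Zhat M i * r); last by ring.
    by rewrite qa; ring.
  by rewrite !big_split -!mulr_sumr -mulr_suml q_sum1 -/X -/Zq /=; ring.
by field; rewrite !gt_eqF.
Qed.

Variable delta' : R.
Hypothesis delta'_itv : 0 < delta' < 4.
Let N := natceil (4 * M * ln (4 / delta')).

(** The number of draws is tuned to the rate [4^-1 / M] per draw, the slowest one met below; each
    bad event then has probability at most [delta' / 4]. *)
Let expN c : 4^-1 <= c -> expR (- (c * N%:R / M)) <= delta' / 4.
Proof.
move=> c4; case/andP: delta'_itv => d0 d4.
have l0 : 0 < ln (4 / delta') by rewrite ln_gt0 // ltr_pdivlMr // mul1r.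
have -> : delta' / 4 = expR (- ln (4 / delta')).
  by rewrite expRN lnK ?posrE ?divr_gt0 // invf_div.
rewrite ler_expR lerN2 ler_pdivlMr // mulrC.
have NN : 4 * M * ln (4 / delta') <= N%:R by apply: natceil_ge.
apply: le_trans (_ : 4^-1 * N%:R <= _); last by rewrite ler_wpM2r.
by lra.
Qed.

Let N_gt0 : 0 < N%:R :> R.
Proof.
case/andP: delta'_itv => d0 d4.
apply: lt_le_trans (natceil_ge _); rewrite !mulr_gt0 //.
by rewrite ln_gt0 // ltr_pdivlMr // mul1r.
Qed.

(** The Chernoff parameter, chosen so that [lam * g] stays in the interval where the linear bounds
    on [expR] apply, with mean [M^-1]. *)
Let lam := (M * Zq)^-1.

Let lam_gt0 : 0 < lam. Proof. by rewrite invr_gt0 mulr_gt0. Qed.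

Let lam_g i : 0 < q i -> 0 <= lam * g (pt i) <= 2^-1.
Proof.
move=> qi; rewrite (mulr_ge0 (ltW lam_gt0) (g_ge0 i)) /lam mulrC ler_pdivrMr ?mulr_gt0 //.
by apply: le_trans (g_le qi) _; rewrite mulrA [M / 2]mulrC.
Qed.

Let lam_Zq : lam * Zq = M^-1.
Proof. by rewrite /lam; field; rewrite !gt_eqF. Qed.

Let sum_lin c : \sum_i q i * (1 + c * (lam * g (pt i))) = 1 + c / M.
Proof.
rewrite (eq_bigr (fun i => q i + c * lam * (q i * g (pt i)))); last by move=> i _; ring.
by rewrite big_split -mulr_sumr q_sum1 -/Zq /= -mulrA lam_Zq.
Qed.

(** The exponential dominates the indicator of an estimate below [Zq / 2]. In units of [M^-1] per
    draw, the exponent is [1/2 - 3/4 = - 1/4]. *)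
Lemma draws_lower_tail :
  expect (sum_draws gp prop N) (fun S => expR (lam * (N%:R * Zq / 2 - S))) <= delta' / 4.
Proof.
rewrite (@eq_expect _ _ _ _ _ _ _ (fun S => expR (lam * (N%:R * Zq / 2)) * expR (- lam * S))).
  rewrite expectZ expect_sum_draws_exp.
  have sle : \sum_i q i * expR (- lam * g (pt i)) <= expR (- (3 / 4) / M).
    apply: le_trans (expR_ge1Dx _); rewrite -sum_lin; apply: ler_sum => i _.
    have := q_ge0 i; rewrite le_eqVlt => /predU1P[<-|qi]; first by rewrite !mul0r.
    by rewrite ler_wpM2l // !mulNr; apply: expRN_le_Bx; apply: lam_g.
  apply: le_trans (ler_wpM2l (expR_ge0 _) (lerXn2r N _ _ sle)) _; rewrite ?nnegrE ?expR_ge0 //.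
    by apply: sumr_ge0 => i _; rewrite mulr_ge0 ?expR_ge0.
  rewrite -expRM_natl -expRD; apply: le_trans (expN (lexx _)); rewrite ler_expR.
  have -> : lam * (N%:R * Zq / 2) = N%:R / 2 / M.
    by rewrite /lam; field; rewrite !gt_eqF.
  by rewrite le_eqVlt; apply/orP; left; apply/eqP; field; rewrite gt_eqF.
by move=> S; rewrite -expRD; congr expR; ring.
Qed.

(** The same for an estimate above [4 * Zq], with exponent [2 - 4 = - 2]. *)
Lemma draws_upper_tail :
  expect (sum_draws gp prop N) (fun S => expR (lam * (S - 4 * (N%:R * Zq)))) <= delta' / 4.
Proof.
rewrite (@eq_expect _ _ _ _ _ _ _ (fun S => expR (- lam * (4 * (N%:R * Zq))) * expR (lam * S))).
  rewrite expectZ expect_sum_draws_exp.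
  have sle : \sum_i q i * expR (lam * g (pt i)) <= expR (2 / M).
    apply: le_trans (expR_ge1Dx _); rewrite -sum_lin; apply: ler_sum => i _.
    have := q_ge0 i; rewrite le_eqVlt => /predU1P[<-|qi]; first by rewrite !mul0r.
    by rewrite ler_wpM2l //; apply: expR_le_Dx; apply: lam_g.
  apply: le_trans (ler_wpM2l (expR_ge0 _) (lerXn2r N _ _ sle)) _; rewrite ?nnegrE ?expR_ge0 //.
    by apply: sumr_ge0 => i _; rewrite mulr_ge0 ?expR_ge0.
  rewrite -expRM_natl -expRD; apply: le_trans (@expN 2 _); last by lra.
  rewrite ler_expR.
  have -> : - lam * (4 * (N%:R * Zq)) = - (4 * N%:R / M).
    by rewrite /lam; field; rewrite !gt_eqF.
  by rewrite le_eqVlt; apply/orP; left; apply/eqP; field; rewrite gt_eqF.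
by move=> S; rewrite -expRD; congr expR; ring.
Qed.

(** Three bad events, an estimate too low, an estimate too high and the failure of all rounds, have
    probability at most [delta' / 4] each and cost at most [2 * B] each. *)
Lemma rejection_sampling_error phi B : (forall i, `|phi (pt i)| <= B) -> 0 <= B ->
  `|expect (rejection_sampling gp prop M delta') phi
    - (\sum_i q i * (g (pt i) * phi (pt i))) / Zq| <= 3 / 2 * B * delta'.
Proof.
move=> phiB B0; case/andP: delta'_itv => d0 d4.
set k := _ / Zq.
have kB : `|k| <= B.
  rewrite /k normrM normfV [`|Zq|]gtr0_norm // ler_pdivrMr //.
  apply: le_trans (ler_norm_sum _ _ _) _; rewrite mulr_sumr; apply: ler_sum => i _.
  rewrite !normrM (ger0_norm (q_ge0 i)) (ger0_norm (g_ge0 i)) [leRHS]mulrCA ler_wpM2l //.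
  by rewrite mulrC ler_wpM2r.
(* Exponentials stand in for the indicators of the two bad estimates, so one pointwise bound in [S]
   can be integrated directly. *)
set bd := fun S => 2 * B * (expR (lam * (N%:R * Zq / 2 - S)) +
   (expR (lam * (S - 4 * (N%:R * Zq))) + delta' / 4)).
have ptw S : 0 <= S ->
  `|expect (rejection_rounds gp prop (S / N%:R) M N) phi - k| <= bd S.
  move=> S0; have B2 : 0 <= 2 * B by rewrite mulr_ge0.
  have triv : `|expect (rejection_rounds gp prop (S / N%:R) M N) phi - k| <= 2 * B * 1.
    apply: le_trans (ler_normB _ _) _; rewrite mulr1 mulr2n mulrDl mul1r lerD //.
    by apply: rejection_rounds_norm; rewrite ?divr_ge0 // ltW.
  have [e1 e2 d4'] : [/\ 0 <= expR (lam * (N%:R * Zq / 2 - S)),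
    0 <= expR (lam * (S - 4 * (N%:R * Zq))) & 0 <= delta' / 4].
    by rewrite !expR_ge0 divr_ge0 // ltW.
  have [lo|lo] := ltP S (N%:R * Zq / 2).
    apply: le_trans triv _; rewrite ler_wpM2l //.
    have : 1 <= expR (lam * (N%:R * Zq / 2 - S)).
      by apply: le_trans (expR_ge1Dx _); rewrite lerDl mulr_ge0 ?subr_ge0 ?ltW.
    by move=> *; lra.
  have [hi|hi] := ltP (4 * (N%:R * Zq)) S.
    apply: le_trans triv _; rewrite ler_wpM2l //.
    have : 1 <= expR (lam * (S - 4 * (N%:R * Zq))).
      by apply: le_trans (expR_ge1Dx _); rewrite lerDl mulr_ge0 ?subr_ge0 ?ltW.
    by move=> *; lra.
  have Zh1 : Zq / 2 <= S / N%:R by rewrite ler_pdivlMr // mulrC mulrA.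
  have Zh2 : S / N%:R <= 4 * Zq by rewrite ler_pdivrMr // mulrAC -mulrA.
  have Zh0 : 0 < S / N%:R by apply: lt_le_trans Zh1; rewrite divr_gt0.
  rewrite rejection_rounds_error // -/k normrM mulrC.
  apply: ler_pM => //.
    apply: le_trans (ler_normB _ _) _; rewrite mulr2n mulrDl mul1r lerD //.
    rewrite -expect_prop.
    exact: (@rejection_rounds_norm (S / N%:R) M 0 phi B (ltW Zh0) (ltW M_gt0)).
  set b := Zq / _.
  have ZM : 0 < S / N%:R * M by rewrite mulr_gt0.
  have b1 : b <= 1.
    rewrite /b ler_pdivrMr // mul1r.
    have -> : Zq = Zq / 2 * 2 by field.
    by apply: ler_pM => //; rewrite ltW // divr_gt0.
  (* An estimate of at most [4 * Zq] keeps the acceptance probability of a round at [(4 * M)^-1] or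
     more. *)
  have b4 : (4 * M)^-1 <= b.
    rewrite /b ler_pdivlMr // mulrC ler_pdivrMr ?mulr_gt0 //.
    by rewrite mulrA [Zq * _]mulrC ler_pM2r.
  rewrite ger0_norm ?exprn_ge0 ?subr_ge0 //.
  suff : (1 - b) ^+ N <= delta' / 4 by lra.
  apply: le_trans (expN (lexx _)).
  have -> : - (4^-1 * N%:R / M) = N%:R * (- (4 * M)^-1).
    by field; rewrite gt_eqF.
  rewrite expRM_natl lerXn2r ?nnegrE ?expR_ge0 ?subr_ge0 //.
  by apply: le_trans (expR_ge1Dx _); lra.
have Ebd : expect (sum_draws gp prop N) bd <= 3 / 2 * B * delta'.
  rewrite /bd expectZ expectD expectD expect_sum_draws_cst q_sum1 expr1n mul1r.
  have -> : 3 / 2 * B * delta' = 2 * B * (delta' / 4 + (delta' / 4 + delta' / 4)) by field.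
  rewrite ler_wpM2l ?mulr_ge0 // lerD ?draws_lower_tail // lerD2r.
  exact: draws_upper_tail.
rewrite /rejection_sampling -/N expect_bind.
have Ek : k = expect (sum_draws gp prop N) (fun=> k).
  by rewrite expect_sum_draws_cst q_sum1 expr1n mul1r.
have -> : forall r, r - k = r + -1 * expect (sum_draws gp prop N) (fun=> k).
  by move=> r; rewrite -Ek mulN1r.
rewrite -expectZ -expectD ler_norml lerNl; apply/andP; split; apply: le_trans Ebd.
  rewrite -[leLHS]mulN1r -expectZ; apply: ler_expect_sum_draws => S S0 /=.
  by rewrite !mulN1r; apply: le_trans (ptw S S0); rewrite -normrN ler_norm.
apply: ler_expect_sum_draws => S S0 /=.
by rewrite mulN1r; apply: le_trans (ptw S S0); rewrite ler_norm.
Qed.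

End Accuracy.
End Rejection.

(** * Prefix masses and coverage *)

Lemma prefix_rcons_tuple (A : finType) H (y : H.-tuple A) (s : seq A) a :
  (size s < H)%N -> prefix (rcons s a) y = prefix s y && (nth a y (size s) == a).
Proof.
move=> sH; rewrite !prefixE size_rcons (take_nth a) ?size_tuple //.
by rewrite eqseq_rcons.
Qed.

Lemma big_option_split (R : nmodType) (A : finType) (F : option A -> R) :
  \sum_i F i = F None + \sum_a F (Some a).
Proof.
rewrite (bigD1 None) //=; congr (_ + _).
rewrite (reindex_omap Some id) /=; last by case.
by apply: eq_bigl => a; rewrite eqxx.
Qed.

Section PrefixMass.
Variables (R : realType) (A : finType) (H : nat).
Implicit Types (f p tau : H.-tuple A -> R) (s : seq A).

Lemma pmass_ge0 f s : (forall y, 0 <= f y) -> 0 <= pmass f s.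
Proof. by move=> f0; apply: sumr_ge0. Qed.

Lemma pmass_nil f : pmass f [::] = \sum_y f y.
Proof. by apply: eq_bigl => y; rewrite prefix0s. Qed.

Lemma pmass_leaf f (y : H.-tuple A) : pmass f y = f y.
Proof.
rewrite /pmass (big_pred1 y) // => z.
by rewrite prefixE size_tuple take_oversize ?size_tuple.
Qed.

Lemma pmass_split f s : (size s < H)%N ->
  \sum_a pmass f (rcons s a) = pmass f s.
Proof.
move=> sH; rewrite /pmass (exchange_big_dep (fun y : H.-tuple A => prefix s y)) /=; last first.
  by move=> a y _; rewrite prefix_rcons_tuple // => /andP[].
apply: eq_bigr => y sy.
case E: (drop (size s) y) => [|b r].
  by move/(congr1 size): E; rewrite size_drop size_tuple => /eqP; rewrite subn_eq0 leqNgt sH.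
rewrite (big_pred1 b) // => a.
by rewrite prefix_rcons_tuple // sy -[size s]addn0 -nth_drop E /= eq_sym.
Qed.

Lemma pmass_rcons_le f s a : (forall y, 0 <= f y) -> (size s < H)%N ->
  pmass f (rcons s a) <= pmass f s.
Proof.
move=> f0 sH; rewrite -(pmass_split f sH) (bigD1 a) //= lerDl.
by apply: sumr_ge0 => b _; apply: pmass_ge0.
Qed.

Lemma pmass_mul_eq0 p tau s : (forall y, 0 <= p y) -> pmass p s = 0 ->
  pmass (fun y => p y * tau y) s = 0.
Proof.
move=> p0 ps; apply: big1 => y sy.
by rewrite (psumr_eq0P _ ps) ?mul0r.
Qed.

(** At a node of mass 0 the conditional is 0 by convention, and the identity survives because the
    child has mass 0 too. *)
Lemma pmass_pnext p s a : (forall y, 0 <= p y) -> (size s < H)%N ->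
  pmass p s * pnext p s a = pmass p (rcons s a).
Proof.
move=> p0 sH; rewrite /pnext mulrC; have [ps|ps] := eqVneq (pmass p s) 0.
  apply/esym/eqP; rewrite ps mulr0 eq_le pmass_ge0 // andbT -ps.
  exact: pmass_rcons_le.
by rewrite mulfVK.
Qed.

Lemma pnext_ge0 p s a : (forall y, 0 <= p y) -> 0 <= pnext p s a.
Proof. by move=> p0; rewrite divr_ge0 ?pmass_ge0. Qed.

Lemma sum_pnext p s : (size s < H)%N -> 0 < pmass p s -> \sum_a pnext p s a = 1.
Proof. by move=> sH ps; rewrite -mulr_suml pmass_split // mulfV ?gt_eqF. Qed.

Lemma sum_pnext_le1 p s : (forall y, 0 <= p y) -> (size s < H)%N ->
  \sum_a pnext p s a <= 1.
Proof.
move=> p0 sH; have := pmass_ge0 s p0; rewrite le_eqVlt => /predU1P[ps|ps].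
  by rewrite big1 ?ler01 // => a _; rewrite /pnext -ps invr0 mulr0.
by rewrite sum_pnext.
Qed.

Lemma Cact_ge0 p tau : 0 <= Cact p tau.
Proof. by apply: bigmax_ge_id. Qed.

Lemma Cact_ge p tau s a : (size s < H)%N ->
  pnext (tilt p tau) s a / pnext p s a <= Cact p tau.
Proof.
move=> sH; pose t : (Ordinal sH).-tuple A := in_tuple s.
apply: le_trans (le_bigmax _ _ (Ordinal sH)).
apply: le_trans (le_bigmax _ _ t).
exact: (le_bigmax _ _ a).
Qed.

Lemma pmass_tilt p tau s : pmass (tilt p tau) s =
  pmass (fun y => p y * tau y) s / \sum_y p y * tau y.
Proof. by rewrite /pmass mulr_suml. Qed.

(** The bound defining the coverage coefficient with denominators cleared; the normalizing constant
    of the target cancels. *)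
Lemma Cact_pmass p tau s a : (forall y, 0 <= p y) ->
  (size s < H)%N -> 0 < \sum_y p y * tau y ->
  0 < pmass (fun y => p y * tau y) s -> 0 < pmass p (rcons s a) ->
  pmass (fun y => p y * tau y) (rcons s a) * pmass p s <=
  Cact p tau * pmass (fun y => p y * tau y) s * pmass p (rcons s a).
Proof.
move=> p0 sH Z0 vs msa.
have ms : 0 < pmass p s by apply: lt_le_trans (pmass_rcons_le a p0 sH).
have := Cact_ge p tau a sH; rewrite /pnext !pmass_tilt.
set v := pmass _ s in vs *; set va := pmass _ (rcons s a) => le.
set Z := \sum_y _ in Z0 le; set m := pmass p s in ms le *.
set ma := pmass p _ in msa le *.
have -> : va * m = va / Z / (v / Z) / (ma / m) * v * ma.
  by field; rewrite !gt_eqF.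
by rewrite ler_wpM2r ?(ltW msa) // ler_wpM2r ?(ltW vs).
Qed.

(** At the root both next-action laws sum to 1, so one cannot be everywhere below a multiple less
    than 1 of the other. *)
Lemma Cact_ge1 p tau : (0 < H)%N -> is_dist p -> (forall y, 0 <= tau y) ->
  0 < \sum_y p y * tau y -> 1 <= Cact p tau.
Proof.
move=> H0 [p0 p1] tau0 Z0.
set v := pmass (fun y => p y * tau y).
have v0 : v [::] = \sum_y p y * tau y by apply: pmass_nil.
have m0 : pmass p [::] = 1 by rewrite pmass_nil.
rewrite -(ler_pM2r Z0) mul1r -{1}v0 -[v [::]](@pmass_split _ [::]) //.
have -> : Cact p tau * \sum_y p y * tau y =
  \sum_a Cact p tau * v [::] * pmass p (rcons [::] a).
  by rewrite -mulr_sumr pmass_split // m0 mulr1 v0.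
apply: ler_sum => a _.
have := pmass_ge0 (rcons [::] a) p0; rewrite le_eqVlt => /predU1P[pa|pa].
  by rewrite pmass_mul_eq0 // -pa mulr0.
have := @Cact_pmass p tau [::] a p0 H0 Z0; rewrite m0 mulr1 -/v; apply=> //.
by rewrite v0.
Qed.

End PrefixMass.

(** * Single steps and costs *)

(** Associativity of [bind] at the level of costs, where no extensionality of continuations is
    involved. *)
Lemma cost_bindA (R : realType) (A : finType) ref V B C D (p : prog R A B)
    (f : B -> prog R A C) (g : C -> prog R A D) :
  cost ref V (bind (bind p f) g) = cost ref V (bind p (fun b => bind (f b) g)).
Proof.
elim: p => //= [p IHp|s k IH|s a k IH|s k IH|b k IH|w k IH].
- by rewrite IHp.
- by rewrite IH.
- by rewrite IH.
- by congr _.+1; apply: eq_bigr => a _; apply: IH.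
- by rewrite !IH.
- by congr (_ + _).+1; apply: eq_bigr => i _; apply: IH.
Qed.

Section StepSmall.
Variables (R : realType) (A : finType) (H : nat).
Variables (ref : seq A -> A -> R) (V : seq A -> R).
Implicit Types (y : seq A).

Definition neighbour_list y : seq (seq A * R) :=
  (if (0 < size y)%N then [:: (parent y, V y)] else [::]) ++
  (if (size y < H)%N then
     [seq (rcons y a, ref y a * V (rcons y a)) | a <- enum A] else [::]).

Lemma expect_child_weights y s phi : expect ref V (child_weights R y s) phi =
  phi [seq (rcons y a, ref y a * V (rcons y a)) | a <- s].
Proof. by elim: s phi => //= a s IH phi; rewrite expect_bind IH. Qed.

Lemma expect_neighbour_weights y phi :
  expect ref V (neighbour_weights R H y) phi = phi (neighbour_list y).
Proof.
rewrite /neighbour_weights /neighbour_list /parent_weight !expect_bind.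
by case: ifP => _ /=; rewrite expect_bind;
   case: ifP => _ //=; rewrite expect_child_weights.
Qed.

Lemma expect_step_small y phi : expect ref V (step_small R H y) phi =
  (\sum_(zc <- neighbour_list y) zc.2 * phi zc.1) /
  \sum_(zc <- neighbour_list y) zc.2.
Proof.
rewrite /step_small expect_bind expect_neighbour_weights /=.
set l := neighbour_list y; set D := \sum_(j < size (unzip2 l)) (unzip2 l)`_j.
have -> : \sum_(zc <- l) zc.2 = D.
  rewrite /D (big_nth (y, 0)) big_mkord size_map; apply: eq_bigr => i _.
by rewrite (nth_map (y, 0)) ?ltn_ord.
rewrite (big_nth (y, 0)) big_mkord size_map mulr_suml; apply: eq_bigr => i _.
by rewrite !(nth_map (y, 0)) ?ltn_ord // mulrAC.
Qed.

Lemma cost_child_weights C y s (k : seq (seq A * R) -> prog R A C) :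
  cost ref V (bind (child_weights R y s) k) =
  (3 * size s + cost ref V
    (k [seq (rcons y a, (ref y a * V (rcons y a))%R) | a <- s]))%N.
Proof.
elim: s k => [|a s IH] k //=.
by rewrite cost_bindA IH /= mulnS.
Qed.

(** At most 1 for the parent, 3 per child, and [#|A| + 2] for the final draw: [4 * #|A| + 3] in
    all. *)
Lemma cost_step_small y : (0 < #|A|)%N -> (cost ref V (step_small R H y) <= 7 * #|A|)%N.
Proof.
move=> A0.
have cc l : cost ref V (Categorical (unzip2 l) (fun i => Ret (nth y (unzip1 l) i))) 
   = (size l).+1.
  by rewrite /= size_map big1 // addn0.
have eA : size (enum A) = #|A| by rewrite -cardE.
rewrite /step_small /neighbour_weights /parent_weight.
move: (enum A) #|A| A0 eA => e n n0 eA; case: ifP => _; case: ifP => _ /=;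
  rewrite ?cost_bindA ?cost_child_weights ?cc /= ?size_map ?big1 ?eA //; lia.
Qed.

End StepSmall.

Lemma cost_lazy_walk (R : realType) (A : finType) ref V
    (step : seq A -> prog R A (seq A)) c T y :
  (forall z, cost ref V (step z) <= c)%N ->
  (cost ref V (lazy_walk step T y) <= c.+1 * T)%N.
Proof.
move=> sc; elim: T y => [|T IH] y //=.
rewrite mulnS addSn ltnS geq_max (leq_trans (IH y)) ?leq_addl //=.
by apply: leq_trans (cost_bind_le _ IH) _; rewrite leq_add2r.
Qed.

Section StepLarge.
Variables (R : realType) (A : finType) (H : nat).
Variables (ref : seq A -> A -> R) (V : seq A -> R).
Implicit Types (y : seq A).

Lemma cost_sum_draws Z (g : Z -> prog R A R) (q : prog R A Z) cg cq N :
  (forall z, cost ref V (g z) <= cg)%N -> (cost ref V q <= cq)%N ->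
  (cost ref V (sum_draws g q N) <= (cq + cg + 1) * N)%N.
Proof.
move=> gc qc; elim: N => [|N IH] //=.
apply: leq_trans (cost_bind_le _ (n := (cg + ((cq + cg + 1) * N + 1))%N) _) _.
  move=> z; apply: leq_trans (cost_bind_le _ (n := ((cq + cg + 1) * N + 1)%N) _) _.
    move=> v; apply: leq_trans (cost_bind_le _ (n := 1%N) _) _ => //.
    by rewrite leq_add2r.
  by rewrite leq_add2r.
by rewrite mulnS; move: qc; lia.
Qed.

Lemma cost_rejection_rounds Z (g : Z -> prog R A R) (q : prog R A Z) cg cq Zhat M N :
  (forall z, cost ref V (g z) <= cg)%N -> (cost ref V q <= cq)%N ->
  (cost ref V (rejection_rounds g q Zhat M N) <= (cq + cg + 4) * N + cq)%N.
Proof.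
move=> gc qc; elim: N => [|N IH] //=; first by rewrite muln0.
apply: leq_trans (cost_bind_le _ (n := (cg + ((cq + cg + 4) * N + cq + 4))%N) _) _.
  move=> z; apply: leq_trans (cost_bind_le _ (n := ((cq + cg + 4) * N + cq + 4)%N) _) _.
    move=> v /=; move: ((cq + cg + 4) * N + cq)%N IH => n IH.
    by rewrite !addnS addn0 !ltnS geq_max /= IH.
  by rewrite leq_add2r.
by rewrite mulnS; move: qc; lia.
Qed.

(** A draw for the estimate costs 4 and a round costs 7; the remaining 3 are one operation and the
    final fresh proposal. *)
Lemma cost_step_large M delta' y :
  (cost ref V (step_large H M delta' y) <= 11 * natceil (4 * M * ln (4 / delta')) + 3)%N.
Proof.
rewrite /step_large /rejection_sampling; set N := natceil _.
have gc z : (cost ref V (proposal_value R y z) <= 1)%N.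
  by rewrite /proposal_value; case: ifP.
have dc : (cost ref V (child_draw R y) <= 1)%N.
  by rewrite /= ltnS; apply/bigmax_leqP.
have qc : (cost ref V (proposal R H y) <= 2)%N.
  rewrite /proposal; case: ifP => _; first exact: leq_trans dc _.
  by case: ifP => _ //=; rewrite ltnS geq_max /=.
apply: leq_trans (cost_bind_le _ (n := (7 * N + 2).+1) _) _.
  by move=> S /=; rewrite ltnS; exact: (cost_rejection_rounds _ _ _ gc qc).
by have := cost_sum_draws N gc qc; lia.
Qed.

End StepLarge.

(** * Conditioning on a leaf *)

Section LeafLaw.
Variables (R : realType) (A : finType) (H : nat).
Variables (ref : seq A -> A -> R) (V : seq A -> R).
Variables (P : prog R A (seq A)) (target : H.-tuple A -> R).
Hypothesis target_dist : is_dist target.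
Local Notation law := (@leaf_law R A H ref V P).
Local Notation leafP := (Pr ref V P (is_leaf H)).

Lemma sum_pred1_leaf s : \sum_(y : H.-tuple A) (s == val y)%:R = (is_leaf H s)%:R :> R.
Proof.
rewrite /is_leaf; case: eqP => [sH|sH].
  pose t := tcast sH (in_tuple s).
  rewrite (bigD1 t) //= val_tcast eqxx big1 ?addr0 // => y yt.
  case: eqP => // sy; case/eqP: yt; apply: val_inj.
  by rewrite [RHS]val_tcast /= -sy.
rewrite big1 // => y _; case: eqP => // sy.
by case: sH; rewrite sy size_tuple.
Qed.

Lemma sum_Pr_pred1 : \sum_(y : H.-tuple A) Pr ref V P (pred1 (val y)) = leafP.
Proof.
rewrite /Pr -expect_sum; apply: eq_expect => s /=.
by rewrite -sum_pred1_leaf.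
Qed.

Lemma sum_leaf_law : \sum_y law y = leafP / leafP.
Proof. by rewrite /leaf_law -mulr_suml sum_Pr_pred1. Qed.

Lemma dTV_leaf_law_le1 :
  (forall y : H.-tuple A, 0 <= Pr ref V P (pred1 (val y))) -> dTV law target <= 1.
Proof.
move=> P0; case: target_dist => t0 t1; rewrite /dTV.
have L0 : 0 <= leafP by rewrite -sum_Pr_pred1; apply: sumr_ge0.
(* When the leaf probability is 0, the conditional law is 0 by the convention on division. *)
have law1 : \sum_y law y <= 1.
  rewrite sum_leaf_law; move: L0; rewrite le_eqVlt => /predU1P[<-|L0].
    by rewrite mul0r.
  by rewrite mulfV ?gt_eqF.
have : \sum_y `|law y - target y| <= \sum_y law y + \sum_y target y.
  rewrite -big_split; apply: ler_sum => y _; apply: le_trans (ler_normB _ _) _.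
  by rewrite !ger0_norm // divr_ge0.
by rewrite t1; lra.
Qed.

(** The distance is half the integral of the sign of the difference. Subtracting the target mean of
    the sign changes nothing, as both laws have mass 1, and yields a centred test function; extended
    by 0 off the leaves, it turns conditioning into a division. *)
Lemma dTV_leaf_law_test : 0 < leafP -> exists phi : seq A -> R,
  [/\ forall s, (size s < H)%N -> phi s = 0,
      forall s, `|phi s| <= 2,
      \sum_y target y * phi y = 0 &
      dTV law target = 2^-1 * (expect ref V P phi / leafP)].
Proof.
move=> L0; case: target_dist => t0 t1.
pose sg y : R := if 0 <= law y - target y then 1 else -1.
pose m := \sum_y sg y * target y.
pose phi s := \sum_(y : H.-tuple A) (sg y - m) * (s == val y)%:R.
have phiE (y : H.-tuple A) : phi y = sg y - m.
  rewrite /phi (bigD1 y) //= eqxx mulr1 big1 ?addr0 // => z zy.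
  by rewrite (inj_eq val_inj) eq_sym (negbTE zy) mulr0.
have phi0 s : size s <> H -> phi s = 0.
  move=> sH; rewrite /phi big1 // => y _; case: eqP => [sy|_]; last by rewrite mulr0.
  by case: sH; rewrite sy size_tuple.
have sg1 y : `|sg y| = 1 by rewrite /sg; case: ifP; rewrite ?normrN normr1.
have m1 : `|m| <= 1.
  apply: le_trans (ler_norm_sum _ _ _) _; rewrite -t1; apply: ler_sum => y _.
  by rewrite normrM sg1 mul1r ger0_norm.
exists phi; split.
- by move=> s sH; apply: phi0 => sE; rewrite sE ltnn in sH.
- move=> s; have [sH|/eqP sH] := eqVneq (size s) H; last by rewrite phi0 // normr0.
  have -> : s = tcast sH (in_tuple s) by rewrite val_tcast.
  rewrite phiE; apply: le_trans (ler_normB _ _) _; rewrite sg1.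
  by rewrite -lerBrDl; apply: le_trans m1 _; lra.
- rewrite (eq_bigr (fun y => sg y * target y - m * target y)).
    by rewrite sumrB -mulr_sumr t1 mulr1 subrr.
  by move=> y _; rewrite phiE; ring.
congr (_ * _).
have -> : expect ref V P phi = \sum_y (sg y - m) * Pr ref V P (pred1 (val y)).
  rewrite /phi expect_sum; apply: eq_bigr => y _; rewrite expectZ.
  by congr (_ * _).
rewrite mulr_suml (eq_bigr (fun y => sg y * law y - sg y * target y)); last first.
  move=> y _; rewrite -mulrBr /sg; case: ifP => [h|/negbT]; first by rewrite ger0_norm ?mul1r.
  by rewrite -ltNge => h; rewrite ltr0_norm // mulN1r.
rewrite [RHS](eq_bigr (fun y => sg y * law y - m * law y)); last first.
  by move=> y _; rewrite /leaf_law; ring.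
by rewrite !sumrB -[in RHS]mulr_sumr sum_leaf_law mulfV ?gt_eqF // mulr1.
Qed.

End LeafLaw.

(** * Numerical bounds for the step count and the number of draws *)

Section Numeric.
Variable R : realType.
Implicit Types x : R.

Lemma lg_ge1 x : 1 <= lg x.
Proof. by rewrite /lg le_max lexx. Qed.

Lemma lg_ge_ln x : ln x <= lg x.
Proof. by rewrite /lg le_max lexx orbT. Qed.

Lemma expR_lg_ge x : 0 < x -> x <= expR (lg x).
Proof. by move=> x0; rewrite -{1}(lnK x0) ler_expR lg_ge_ln. Qed.

Lemma expR_Nlg_le x : 0 < x -> expR (- lg x^-1) <= x.
Proof.
move=> x0; rewrite expRN invf_ple ?posrE ?expR_gt0 //.
by apply: expR_lg_ge; rewrite invr_gt0.
Qed.

Lemma pow2_le_expR n : 2 ^+ n <= expR n%:R :> R.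
Proof.
rewrite -[n%:R]mulr1 expRM_natl lerXn2r ?nnegrE ?expR_ge0 //.
exact: (expR_ge1Dx 1).
Qed.

(* With [a = lg delta^-1] the error [expR (- a)] is at most [min delta 1]. *)
Lemma mixing_time H (kap a : R) T : (0 < H)%N -> 1 <= kap -> 1 <= a ->
  100 * H%:R ^+ 2 * kap ^+ 4 * a * lg (H%:R * kap) <= T%:R ->
  (1 - (4 * kap ^+ 2 * H%:R ^+ 2)^-1) ^+ T * (2 * kap ^+ 2 * H%:R) <=
  (expR (- a) / (64 * (kap * H%:R))) ^+ 2.
Proof.
move=> H0 k1 a1 hT; set b := lg _ in hT.
have b1 : 1 <= b by apply: lg_ge1.
have h1 : 1 <= H%:R :> R by rewrite ler1n.
set h := H%:R in h1 hT *.
have kh1 : 1 <= kap * h by rewrite mulr_ege1.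
have kh0 : 0 < kap * h by apply: lt_le_trans kh1.
have k0 : 0 < kap by apply: lt_le_trans k1.
have h0 : 0 < h by apply: lt_le_trans h1.
have khb : kap * h <= expR b by rewrite /b mulrC; apply: expR_lg_ge; rewrite mulrC.
have c0 : 0 < 4 * kap ^+ 2 * h ^+ 2 by rewrite !mulr_gt0 ?exprn_gt0.
have c1 : 1 <= 4 * kap ^+ 2 * h ^+ 2 by rewrite !mulr_ege1 ?exprn_ege1 ?ler1n.
(* The factor [kap ^+ 4] in the step count exceeds what the rate requires by [kap ^+ 2], which is
   dropped here. *)
have rT : (1 - (4 * kap ^+ 2 * h ^+ 2)^-1) ^+ T <= expR (- (25 * (a * b))).
  apply: (@le_trans _ _ (expR (T%:R * - (4 * kap ^+ 2 * h ^+ 2)^-1))).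
    rewrite expRM_natl lerXn2r ?nnegrE ?expR_ge0 ?subr_ge0 ?invf_le1 //.
    exact: expR_ge1Dx.
  rewrite ler_expR mulrN lerN2 ler_pdivlMr //; apply: le_trans hT.
  have -> : 25 * (a * b) * (4 * kap ^+ 2 * h ^+ 2) =
     100 * h ^+ 2 * a * b * kap ^+ 2 * 1 by ring.
  have -> : 100 * h ^+ 2 * kap ^+ 4 * a * b =
     100 * h ^+ 2 * a * b * kap ^+ 2 * kap ^+ 2 by ring.
  apply: ler_wpM2l; last exact: exprn_ege1.
  by do ?apply: mulr_ge0; rewrite ?exprn_ge0 // ltW // (lt_le_trans ltr01).
apply: le_trans (ler_wpM2r _ rT) _; first by rewrite !mulr_ge0 ?exprn_ge0 ?ltW.
rewrite expr_div_n ler_pdivlMr ?exprn_gt0 ?mulr_gt0 //.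
(* Here [2 * 64 ^+ 2 = 2 ^+ 13], and the powers of [kap] and [h] are absorbed by
   [(kap * h) ^+ 4]. *)
have poly : 2 * kap ^+ 2 * h * (64 * (kap * h)) ^+ 2 <= 2 ^+ 13 * expR b ^+ 4.
  apply: (@le_trans _ _ (2 ^+ 13 * (kap * h) ^+ 4)); last first.
    by rewrite ler_wpM2l ?exprn_ge0 // lerXn2r ?nnegrE ?expR_ge0 // ltW.
  have -> : 2 * kap ^+ 2 * h * (64 * (kap * h)) ^+ 2 = 2 ^+ 13 * (kap * h) ^+ 2 * (kap ^+ 2 * h).
    by ring.
  have -> : 2 ^+ 13 * (kap * h) ^+ 4 = 2 ^+ 13 * (kap * h) ^+ 2 * (kap ^+ 2 * h * h) by ring.
  apply: ler_wpM2l.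
    by apply: mulr_ge0; apply: exprn_ge0 => //; apply: ltW.
  by apply: ler_peMr => //; apply: mulr_ge0; rewrite ?exprn_ge0 ?ltW.
rewrite -[leLHS]mulrA; apply: le_trans (ler_wpM2l (expR_ge0 _) poly) _.
apply: (@le_trans _ _ (expR (- (25 * (a * b))) * (expR 13 * expR b ^+ 4))).
  rewrite ler_wpM2l ?expR_ge0 // ler_wpM2r ?exprn_ge0 ?expR_ge0 //.
  exact: (pow2_le_expR 13).
rewrite -!expRM_natl -!expRD ler_expR.
(* It remains that [13 + 4 * b + 2 * a <= 25 * (a * b)], where 1, [a] and [b] are all at most
   [a * b]. *)
have ab1 : a <= a * b by rewrite ler_peMr // (le_trans ler01).
have ab2 : b <= a * b by rewrite ler_peMl // (le_trans ler01).
by move: (a * b) ab1 ab2 => ab ab1 ab2; lra.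
Qed.

Lemma vgb_steps_ge C k H (epsV delta : R) :
  C%:R * H%:R ^+ 2 * (1 + epsV) ^+ 4 * lg delta^-1 * lg (H%:R * (1 + epsV)) ^+ k <=
  (vgb_steps C k H epsV delta)%:R.
Proof. exact: natceil_ge. Qed.

(** With [ln (2 ^+ 6) <= 6] the logarithm is at most [7 * lg (N / d)], giving [4 * 4 * 7 = 112];
    rounding up adds 1. *)
Lemma natceil_draws_le (c d N : R) : 1 <= c -> 0 < d -> 1 <= N ->
  (natceil (4 * (4 * c) * ln (4 / (d / (16 * N)))))%:R <=
  113 * c * lg (N / d).
Proof.
move=> c1 d0 N1; apply: le_trans (natceil_le _) _.
have l1 := lg_ge1 (N / d).
have N0 : 0 < N by apply: lt_le_trans N1.
have cl : 1 <= c * lg (N / d) by rewrite mulr_ege1.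
have -> : 4 / (d / (16 * N)) = 2 ^+ 6 * (N / d) by field; rewrite !gt_eqF.
rewrite lnM ?posrE ?exprn_gt0 ?divr_gt0 //.
have l2 : ln (2 ^+ 6) <= 6 :> R.
  by rewrite -[leRHS]expRK ler_ln ?posrE ?expR_gt0 ?exprn_gt0 // (pow2_le_expR 6).
have l3 := lg_ge_ln (N / d).
have : 4 * (4 * c) * (ln (2 ^+ 6) + ln (N / d)) <= 4 * (4 * c) * (7 * lg (N / d)).
  by rewrite ler_wpM2l //; lra.
move: cl; set L := lg _; set X := ln _ + ln _ => cl le.
have : Num.max 0 (4 * (4 * c) * X) <= 112 * (c * L).
  by rewrite ge_max; apply/andP; split; lra.
by move=> le2; lra.
Qed.

End Numeric.

(** * VGB on the model *)

Section ModelWalk.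
Variables (R : realType) (A : finType) (H : nat).
Variables (p tau : H.-tuple A -> R) (V : seq A -> R) (kap : R).
Hypothesis H_gt0 : (0 < H)%N.
Hypothesis p_dist : is_dist p.
Hypothesis tau_ge0 : forall y, 0 <= tau y.
Hypothesis Z_gt0 : 0 < \sum_y p y * tau y.
Hypothesis V_ge0 : forall s, (size s <= H)%N -> 0 <= V s.
Hypothesis kap_ge1 : 1 <= kap.
Hypothesis V_leaf : forall y : H.-tuple A, V y = tau y.
Hypothesis V_ratio : forall s, (1 <= size s < H)%N -> 0 < pmass p s ->
  Vstar p tau s / kap <= V s <= kap * Vstar p tau s.
Implicit Types (s : seq A) (f : seq A -> R).

Local Notation mu := (pmass p).
Local Notation ref := (pnext p).
Local Notation Ca := (Cact p tau).

Definition tilted_mass s : R := pmass (fun y => p y * tau y) s.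
Local Notation v := tilted_mass.

Definition edge_weight s : R := mu s * V s.
Local Notation w := edge_weight.
Local Notation nbs := (nbsum H w).
Local Notation dg := (deg H w).

Let p_ge0 y : 0 <= p y. Proof. by case: p_dist. Qed.

Let kap_gt0 : 0 < kap. Proof. exact: lt_le_trans kap_ge1. Qed.

Lemma tilted_mass_ge0 s : 0 <= v s.
Proof. by apply: pmass_ge0 => y; rewrite mulr_ge0. Qed.

Lemma tilted_mass_split s : (size s < H)%N -> \sum_a v (rcons s a) = v s.
Proof. exact: pmass_split. Qed.

Lemma tilted_mass_rcons_le s a : (size s < H)%N -> v (rcons s a) <= v s.
Proof. by move=> sH; apply: pmass_rcons_le => // y; rewrite mulr_ge0. Qed.

Lemma tilted_mass_root : v [::] = \sum_y p y * tau y.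
Proof. exact: pmass_nil. Qed.

Lemma tilted_mass_root_gt0 : 0 < v [::].
Proof. by rewrite tilted_mass_root. Qed.

Lemma edge_weight_ge0 s : (size s <= H)%N -> 0 <= w s.
Proof. by move=> sH; rewrite mulr_ge0 ?V_ge0 ?pmass_ge0. Qed.

Lemma edge_weight_leaf s : size s = H -> w s = v s.
Proof.
move=> sH; have -> : s = tcast sH (in_tuple s) by rewrite val_tcast.
by rewrite /edge_weight /tilted_mass V_leaf !pmass_leaf.
Qed.

(** Leaves use the exact tilt, at nodes of mass 0 both sides vanish, and elsewhere the ratio bound
    is multiplied by the mass. *)
Lemma edge_weight_ratio s : (0 < size s <= H)%N ->
  w s <= kap * v s /\ v s <= kap * w s.
Proof.
case/andP => s0; rewrite leq_eqVlt => /predU1P[sH|sH].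
  by rewrite edge_weight_leaf // ler_peMl ?tilted_mass_ge0.
have := pmass_ge0 s p_ge0; rewrite le_eqVlt => /predU1P[ms|ms].
  by rewrite /edge_weight /tilted_mass pmass_mul_eq0 // -ms !(mul0r, mulr0).
have := @V_ratio s; rewrite s0 sH => /(_ isT ms).
have -> : Vstar p tau s = v s / mu s by [].
case/andP=> lo hi; rewrite /edge_weight; split.
  have := ler_wpM2l (ltW ms) hi; congr (_ <= _); field; rewrite gt_eqF //.
have := ler_wpM2l (ltW kap_gt0) (ler_wpM2l (ltW ms) lo); congr (_ <= _).
by field; rewrite !gt_eqF.
Qed.

Let w_le s (sH : (0 < size s <= H)%N) := proj1 (edge_weight_ratio sH).
Let v_le s (sH : (0 < size s <= H)%N) := proj2 (edge_weight_ratio sH).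

Lemma deg_tilted_mass s : (size s <= H)%N -> v s <= kap * dg s.
Proof. exact: (deg_ge H_gt0 kap_ge1 edge_weight_ge0 tilted_mass_split v_le). Qed.

Lemma deg_gt0 s : (size s <= H)%N -> 0 < v s -> 0 < dg s.
Proof.
by move=> sH vs; rewrite -(pmulr_rgt0 _ kap_gt0) (lt_le_trans vs) ?deg_tilted_mass.
Qed.

(* Zero-mass nodes are never reached by the exact walk; only on them do the
   transition weights fail to be normalized. *)
Lemma norm_nbsum_reachable s f B : (size s <= H)%N ->
  (forall n, (size n <= H)%N -> 0 < v n -> `|f n| <= B) ->
  `|nbs s f| <= dg s * B.
Proof.
move=> sH fB; apply: norm_nbsum_le => //; first exact: edge_weight_ge0.
  move=> s0 ws; case/lastP: s s0 sH ws => // s a _; rewrite size_rcons => sH ws.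
  rewrite parent_rcons; apply: fB; first exact: ltnW.
  apply: lt_le_trans (tilted_mass_rcons_le a sH).
  rewrite -(pmulr_rgt0 _ kap_gt0) (lt_le_trans ws) // w_le // size_rcons.
  by rewrite sH.
move=> a sH' wa; apply: fB; first by rewrite size_rcons.
rewrite -(pmulr_rgt0 _ kap_gt0) (lt_le_trans wa) // w_le // size_rcons.
by rewrite sH'.
Qed.

(** * Exact steps *)

Section Small.

Definition kernel_small f s : R := expect ref V (step_small R H s) f.

(** Multiplying by the mass of the node turns the conditional weights of its children into edge
    weights. *)
Lemma nbsum_neighbour_list s f :
  mu s * (\sum_(zc <- neighbour_list H ref V s) zc.2 * f zc.1) = nbs s f.
Proof.
rewrite /neighbour_list big_cat mulrDr /nbsum; congr (_ + _).
  case: ifP => _; last by rewrite big_nil mulr0 mul0r.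
  by rewrite big_seq1 mul1r mulrA.
case: ifP => sH; last by rewrite big_nil mulr0 mul0r.
rewrite big_map big_enum mul1r mulr_sumr; apply: eq_bigr => a _ /=.
by rewrite /edge_weight -(pmass_pnext a p_ge0 sH) !mulrA.
Qed.

Lemma kernel_smallE f s : (size s <= H)%N -> dg s * kernel_small f s = nbs s f.
Proof.
move=> sH; rewrite /kernel_small expect_step_small -nbsum_neighbour_list.
have -> : dg s = mu s * \sum_(zc <- neighbour_list H ref V s) zc.2.
  rewrite /deg -nbsum_neighbour_list; congr (_ * _).
  by apply: eq_bigr => zc _; rewrite mulr1.
set l := neighbour_list _ _ _ _; set D := \sum_(_ <- _) _.
rewrite -mulrA; congr (_ * _).
(* If the weights sum to 0, nonnegativity makes each of them 0, so both sides vanish. *)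
have [D0|D0] := eqVneq D 0; last by rewrite mulrC mulfVK.
have l0 zc : zc \in l -> 0 <= zc.2.
  rewrite mem_cat => /orP[]; case: ifP => // sH'.
    by rewrite inE => /eqP -> /=; apply: V_ge0.
  by case/mapP=> a _ -> /=; rewrite mulr_ge0 ?pnext_ge0 ?V_ge0 // size_rcons.
rewrite D0 mul0r big_seq big1 // => zc zcl.
move/eqP: D0; rewrite /D big_seq psumr_eq0 //.
by move=> /allP /(_ _ zcl) /implyP /(_ zcl) /eqP ->; rewrite mul0r.
Qed.

Lemma expect_lazy_walk_small t s f :
  expect ref V (lazy_walk (step_small R H) t s) f = lazy_iter kernel_small t f s.
Proof.
elim: t s => //= t IH s; rewrite expect_bind /lazy_step IH.
have -> : 1 - 2^-1 = 2^-1 :> R by field.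
by congr (_ + _ * _); apply: eq_expect => b; apply: IH.
Qed.

Lemma expect_lazy_walk_small_root t f B :
  tsum H (fun s => dg s * f s) = 0 ->
  (forall s, (size s <= H)%N -> `|f s| <= B) ->
  expect ref V (lazy_walk (step_small R H) t [::]) f ^+ 2 <=
  (1 - (4 * kap ^+ 2 * H%:R ^+ 2)^-1) ^+ t * (2 * kap ^+ 2 * H%:R * B ^+ 2).
Proof.
rewrite expect_lazy_walk_small => f0 fB.
exact: (lazy_iter_root H_gt0 kap_ge1 edge_weight_ge0 tilted_mass_ge0
  tilted_mass_split w_le v_le kernel_smallE t tilted_mass_root_gt0 f0 fB).
Qed.

(** On the leaves the degree is the unnormalized target, because the outcome-level tilt is exact. *)
Lemma tsum_leafE f : (forall s, (size s < H)%N -> f s = 0) ->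
  tsum H (fun s => dg s * f s) = \sum_(y : H.-tuple A) p y * tau y * f y.
Proof.
move=> f0; rewrite tsum_leaf => [|s sH]; last by rewrite f0 ?mulr0.
apply: eq_bigr => y _; rewrite deg_leaf ?size_tuple // edge_weight_leaf ?size_tuple //.
by rewrite /tilted_mass pmass_leaf.
Qed.

Lemma tsum_degE_le : tsum H dg <= 2 * kap * H%:R * \sum_y p y * tau y.
Proof.
rewrite -tilted_mass_root.
exact: (tsum_deg_le tilted_mass_split w_le).
Qed.

Lemma kernel_small_norm f s B : (size s <= H)%N -> 0 < v s ->
  (forall n, (size n <= H)%N -> 0 < v n -> `|f n| <= B) ->
  `|kernel_small f s| <= B.
Proof.
move=> sH vs fB; have d0 := deg_gt0 sH vs.
by rewrite -(ler_pM2l d0) -{1}(gtr0_norm d0) -normrM kernel_smallE // norm_nbsum_reachable.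
Qed.

Lemma kernel_small_cst c s : (size s <= H)%N -> 0 < v s -> kernel_small (fun=> c) s = c.
Proof.
move=> sH vs; have d0 := deg_gt0 sH vs.
by apply: (mulfI (lt0r_neq0 d0)); rewrite kernel_smallE // nbsum_cst.
Qed.

End Small.

(** * Rejection-sampling steps *)

Section Large.

(** [None] stands for the parent and [Some a] for the child along [a]. *)
Definition proposal_weight s (i : option A) : R :=
  match i with
  | None => if size s == 0%N then 0 else if (size s < H)%N then 2^-1 else 1
  | Some a => if size s == 0%N then ref s a
              else if (size s < H)%N then 2^-1 * ref s a else 0
  end.

(* At a leaf the children have weight 0 and are replaced by the parent, so that
   all the points have depth at most [H]. *)
Definition proposal_point s (i : option A) : seq A :=
  if i is Some a then (if (size s < H)%N then rcons s a else parent s) else parent s.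

Definition neighbour_value s z : R := if (size z < size s)%N then V s else V z.

Lemma size_parent s : size (parent s) = (size s).-1.
Proof. by rewrite /parent size_take; case: (size s) => //= n; rewrite ltnS leqnn. Qed.

Lemma size_proposal_point s i : (size s <= H)%N -> (size (proposal_point s i) <= H)%N.
Proof.
move=> sH; case: i => [a|] /=; last by rewrite size_parent; lia.
by case: ifP; rewrite ?size_rcons // size_parent; lia.
Qed.

Lemma expect_proposal s f : expect ref V (proposal R H s) f =
  \sum_i proposal_weight s i * f (proposal_point s i).
Proof.
rewrite big_option_split /proposal /= /child_draw.
case: (size s =P 0%N) => s0 /=.
  by rewrite mul0r add0r s0 H_gt0.
case: ifP => sH /=; last by rewrite big1 ?addr0 ?mul1r // => a _; rewrite mul0r.
have -> : 1 - 2^-1 = 2^-1 :> R by field.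
by rewrite mulr_sumr; congr (_ + _); apply: eq_bigr => a _; rewrite mulrA.
Qed.

Lemma expect_proposal_value s z (f : R -> R) :
  expect ref V (proposal_value R s z) f = f (neighbour_value s z).
Proof. by rewrite /proposal_value /neighbour_value; case: ifP. Qed.

Lemma proposal_weight_ge0 s i : 0 <= proposal_weight s i.
Proof.
have r0 a : 0 <= ref s a by apply: pnext_ge0.
case: i => [a|] /=; (case: ifP => _; [|case: ifP => _]) => //.
  by apply: mulr_ge0 => //; rewrite invr_ge0.
by rewrite invr_ge0.
Qed.

Lemma proposal_weight_sum1 s : (size s <= H)%N -> 0 < mu s ->
  \sum_i proposal_weight s i = 1.
Proof.
move=> sH ms; rewrite big_option_split /=.
case: eqP => s0; first by rewrite add0r sum_pnext // s0.
case: ltnP => sH'; last by rewrite big1 ?addr0.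
by rewrite -mulr_sumr sum_pnext // mulr1; field.
Qed.

Lemma proposal_weight_sum_le1 s : \sum_i proposal_weight s i <= 1.
Proof.
rewrite big_option_split /=.
case: eqP => s0; first by rewrite add0r sum_pnext_le1 // s0.
case: ltnP => sH'; last by rewrite big1 ?addr0.
rewrite -mulr_sumr; have := sum_pnext_le1 p_ge0 sH'; lra.
Qed.

Lemma neighbour_value_parent s : (0 < size s)%N -> neighbour_value s (parent s) = V s.
Proof. by move=> s0; rewrite /neighbour_value size_parent ltn_predL s0. Qed.

Lemma neighbour_value_child s a : neighbour_value s (rcons s a) = V (rcons s a).
Proof. by rewrite /neighbour_value size_rcons ltnNge leqnSn. Qed.

Lemma neighbour_value_ge0 s i : (size s <= H)%N ->
  0 <= neighbour_value s (proposal_point s i).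
Proof.
by move=> sH; rewrite /neighbour_value; case: ifP => _; rewrite V_ge0 ?size_proposal_point.
Qed.

(** Compensates the factor 1/2 that the proposal puts on both directions at an inner node. *)
Definition proposal_factor s : R := if (0 < size s < H)%N then 2 else 1.

Lemma proposal_factor_itv s : 1 <= proposal_factor s <= 2.
Proof. by rewrite /proposal_factor; case: ifP; rewrite ?lexx ?ler1n. Qed.

(** The proposal reweighted by the value is proportional to the exact transition weights, so
    rejection sampling aims at the exact step. *)
Lemma nbsum_proposal s f : (size s <= H)%N ->
  proposal_factor s * mu s * (\sum_i proposal_weight s i *
    (neighbour_value s (proposal_point s i) * f (proposal_point s i))) = nbs s f.
Proof.
move=> sH; rewrite big_option_split /nbsum mulrDr /proposal_factor /=.
have cE : (size s < H)%N -> \sum_a w (rcons s a) * f (rcons s a) =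
   mu s * \sum_a ref s a * (V (rcons s a) * f (rcons s a)).
  move=> sH'; rewrite mulr_sumr; apply: eq_bigr => a _.
  by rewrite /edge_weight -(pmass_pnext a p_ge0 sH') !mulrA.
have cE' : \sum_a ref s a * (neighbour_value s (rcons s a) * f (rcons s a)) =
   \sum_a ref s a * (V (rcons s a) * f (rcons s a)).
  by apply: eq_bigr => a _; rewrite neighbour_value_child.
case: (posnP (size s)) => [s0|s0] /=.
  by rewrite s0 /= H_gt0 cE ?s0 // cE' !(mul0r, mul1r, mulr0).
rewrite neighbour_value_parent //.
case: (ltnP (size s) H) => sH'.
  rewrite cE // -cE' !mul1r /edge_weight; congr (_ + _); first by field.
  under eq_bigr => a _ do rewrite -mulrA.
  by rewrite -mulr_sumr; field.
rewrite !mul1r mul0r /edge_weight; congr (_ + _); first by rewrite mulrA.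
by rewrite big1 ?mulr0 ?mul0r // => a _; rewrite mul0r.
Qed.

Lemma deg_proposal s : (size s <= H)%N ->
  proposal_factor s * mu s * (\sum_i proposal_weight s i *
    neighbour_value s (proposal_point s i)) = dg s.
Proof.
move=> sH; rewrite /deg -nbsum_proposal //; congr (_ * _).
by apply: eq_bigr => i _; rewrite mulr1.
Qed.

Local Notation M := (4 * Ca * kap ^+ 2).

Let Ca_ge1 : 1 <= Ca. Proof. exact: Cact_ge1. Qed.

Let M_ge0 : 0 <= M.
Proof. by rewrite !mulr_ge0 ?exprn_ge0 ?Cact_ge0 // ltW. Qed.

Lemma mass_gt0 s : 0 < v s -> 0 < mu s.
Proof.
move=> vs; rewrite lt_neqAle pmass_ge0 // andbT.
by apply: contraTneq vs => m0; rewrite /tilted_mass pmass_mul_eq0 ?ltxx.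
Qed.

(** This justifies the choice of [M]. For the parent, [w s] is a summand of the degree. For a child,
    one [kap] passes from [w] to the flow, [Ca] bounds the relative growth of the flow, and another
    [kap] passes from the flow at [s] to its degree. *)
Lemma neighbour_value_le s i : (size s <= H)%N -> 0 < v s ->
  0 < proposal_weight s i ->
  neighbour_value s (proposal_point s i) <= M / 2 *
   \sum_i proposal_weight s i * neighbour_value s (proposal_point s i).
Proof.
move=> sH vs qi; have ms := mass_gt0 vs; have d0 := deg_gt0 sH vs.
have /andP[c1 c2] := proposal_factor_itv s.
have cm : 0 < proposal_factor s * mu s by rewrite mulr_gt0 // (lt_le_trans ltr01).
rewrite -(ler_pM2l cm) mulrCA deg_proposal //.
have k2 : 1 <= kap ^+ 2 by rewrite exprn_ege1.
have M2 : 2 <= M / 2.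
  have -> : M / 2 = 2 * (Ca * kap ^+ 2) by field.
  by rewrite ler_peMr // mulr_ege1.
have parent_case : (0 < size s)%N ->
    proposal_factor s * mu s * neighbour_value s (parent s) <= M / 2 * dg s.
  move=> s0; rewrite neighbour_value_parent // -mulrA -/(edge_weight s).
  have ws := edge_weight_ge0 sH.
  have wd : w s <= dg s.
    rewrite /deg /nbsum s0 mul1r mulr1 lerDl; case: ltnP => sH'; rewrite ?mul0r // mul1r.
    by apply: sumr_ge0 => a _; rewrite mulr1 edge_weight_ge0 // size_rcons.
  apply: ler_pM => //; first by rewrite (le_trans ler01).
  exact: le_trans c2 M2.
have child_case a : (size s < H)%N -> 0 < ref s a ->
    proposal_factor s * mu s * neighbour_value s (rcons s a) <= M / 2 * dg s.
  move=> sH' ra; rewrite neighbour_value_child -mulrA.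
  have ma : 0 < mu (rcons s a) by rewrite -pmass_pnext // mulr_gt0.
  have -> : M / 2 * dg s = 2 * (Ca * kap ^+ 2 * dg s) by field.
  apply: ler_pM => //; first by rewrite (le_trans ler01).
    by rewrite mulr_ge0 ?(ltW ms) ?V_ge0 // size_rcons.
  have sa : (0 < size (rcons s a) <= H)%N by rewrite size_rcons sH'.
  rewrite -(ler_pM2r ma).
  have -> : mu s * V (rcons s a) * mu (rcons s a) = mu s * w (rcons s a).
    by rewrite /edge_weight; ring.
  apply: le_trans (ler_wpM2l (ltW ms) (w_le sa)) _.
  have c := Cact_pmass p_ge0 sH' Z_gt0 vs ma.
  have -> : mu s * (kap * v (rcons s a)) = kap * (v (rcons s a) * mu s) by ring.
  apply: le_trans (ler_wpM2l (ltW kap_gt0) c) _; rewrite -/(v s).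
  have -> : Ca * kap ^+ 2 * dg s * mu (rcons s a) =
    kap * (Ca * (kap * dg s) * mu (rcons s a)) by ring.
  rewrite ler_wpM2l ?(ltW kap_gt0) // ler_wpM2r ?(ltW ma) //.
  by rewrite ler_wpM2l ?Cact_ge0 // deg_tilted_mass.
case: i qi => [a|] /=; last first.
  by case: posnP => [_|s0] /=; [rewrite ltxx | move=> _; exact: parent_case].
case: posnP => [s0|s0] /=.
  by rewrite s0 H_gt0; apply: child_case; rewrite s0.
case: ifP => sH'; last by rewrite ltxx.
by rewrite pmulr_rgt0 ?invr_gt0 // => ra; apply: child_case.
Qed.

Lemma expect_lazy_walkS (step : seq A -> prog R A (seq A)) t s f :
  expect ref V (lazy_walk step t.+1 s) f =
  2^-1 * expect ref V (lazy_walk step t s) f +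
  2^-1 * expect ref V (step s) (fun b => expect ref V (lazy_walk step t b) f).
Proof. by rewrite /= expect_bind; congr (_ + _ * _); field. Qed.

Lemma step_large_error delta' f B s : 0 < delta' < 4 -> 0 <= B ->
  (size s <= H)%N -> 0 < v s ->
  (forall n, (size n <= H)%N -> `|f n| <= B) ->
  `|expect ref V (step_large H M delta' s) f - kernel_small f s| <= 3 / 2 * B * delta'.
Proof.
move=> d4 B0 sH vs fB; have d0 := deg_gt0 sH vs; have ms := mass_gt0 vs.
have /andP[c1 _] := proposal_factor_itv s.
have cm : 0 < proposal_factor s * mu s by rewrite mulr_gt0 // (lt_le_trans ltr01).
set Zq := \sum_i proposal_weight s i * neighbour_value s (proposal_point s i).
have dE : proposal_factor s * mu s * Zq = dg s by apply: deg_proposal.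
have Zq0 : 0 < Zq by rewrite -(pmulr_rgt0 _ cm) dE.
have -> : kernel_small f s = (\sum_i proposal_weight s i *
    (neighbour_value s (proposal_point s i) * f (proposal_point s i))) / Zq.
  apply: (mulfI (lt0r_neq0 d0)).
  by rewrite kernel_smallE // -nbsum_proposal // -dE mulrACA mulfV ?gt_eqF // mulr1.
apply: (rejection_sampling_error (expect_proposal s) (expect_proposal_value s)) => //.
- exact: proposal_weight_ge0.
- exact: proposal_weight_sum_le1.
- by move=> i; apply: neighbour_value_ge0.
- exact: proposal_weight_sum1.
- by move=> i; apply: neighbour_value_le.
- by move=> i; apply: fB; apply: size_proposal_point.
Qed.

(** Needed at every node: when all rounds fail, the fallback draw may land on a node of no target
    mass. *)
Lemma lazy_walk_large_norm delta' t f B s : 0 <= B -> (size s <= H)%N ->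
  (forall n, (size n <= H)%N -> `|f n| <= B) ->
  `|expect ref V (lazy_walk (step_large H M delta') t s) f| <= B.
Proof.
move=> B0 sH fB; elim: t s sH => [|t IH] s sH /=; first exact: fB.
have -> : 1 - 2^-1 = 2^-1 :> R by field.
rewrite expect_bind.
have h1 := IH s sH; set x := expect _ _ _ _ in h1 *; set y := expect _ _ _ _.
suff h2 : `|y| <= B.
  by rewrite -mulrDr normrM ger0_norm //; move: (ler_normD x y); lra.
apply: (rejection_sampling_norm (expect_proposal s) (expect_proposal_value s)) => //.
- exact: proposal_weight_ge0.
- exact: proposal_weight_sum_le1.
- by move=> i; apply: neighbour_value_ge0.
- by move=> i; apply: IH; apply: size_proposal_point.
Qed.

Lemma lazy_walk_large_ge0 delta' t f s : (size s <= H)%N ->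
  (forall n, 0 <= f n) ->
  0 <= expect ref V (lazy_walk (step_large H M delta') t s) f.
Proof.
move=> sH f0; elim: t s sH => [|t IH] s sH /=; first exact: f0.
have -> : 1 - 2^-1 = 2^-1 :> R by field.
rewrite expect_bind -mulrDr mulr_ge0 ?invr_ge0 // addr_ge0 ?IH //.
apply: (rejection_sampling_ge0 (expect_proposal s) (expect_proposal_value s)) => //.
- exact: proposal_weight_ge0.
- by move=> i; apply: neighbour_value_ge0.
- by move=> i; apply: IH; apply: size_proposal_point.
Qed.

(** Steps are replaced one at a time: the inexact step is compared on the remaining inexact walk,
    which is bounded everywhere, and the exact kernel then averages the earlier error over reachable
    nodes. Laziness halves the error of a step. *)
Lemma lazy_walk_error delta' t f B s : 0 < delta' < 4 -> 0 <= B ->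
  (size s <= H)%N -> 0 < v s ->
  (forall n, (size n <= H)%N -> `|f n| <= B) ->
  `|expect ref V (lazy_walk (step_large H M delta') t s) f -
    expect ref V (lazy_walk (step_small R H) t s) f| <= t%:R * (3 / 4 * B * delta').
Proof.
move=> d4 B0 sH vs fB; set c := 3 / 4 * B * delta'.
elim: t s sH vs => [|t IH] s sH vs; first by rewrite subrr normr0 mul0r.
rewrite !expect_lazy_walkS.
set ul := fun b => expect ref V (lazy_walk (step_large H M delta') t b) f.
set us := fun b => expect ref V (lazy_walk (step_small R H) t b) f.
have h1 : `|ul s - us s| <= t%:R * c by apply: IH.
have h2 := step_large_error (f := ul) d4 B0 sH vs
  (fun n nH => lazy_walk_large_norm delta' t B0 nH fB).
have h3 : `|kernel_small ul s - kernel_small us s| <= t%:R * c.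
  have -> : kernel_small ul s - kernel_small us s = kernel_small (fun n => ul n + -1 * us n) s.
    by rewrite /kernel_small expectD expectZ mulN1r.
  by apply: kernel_small_norm => // n nH vn; rewrite mulN1r; apply: IH.
move: h1 h2 h3; rewrite -/(kernel_small us s) -/(ul s) -/(us s).
have -> : 3 / 2 * B * delta' = 2 * c by rewrite /c; field.
have -> : t.+1%:R * c = t%:R * c + c by rewrite -natr1 mulrDl mul1r.
move: (t%:R * c) => e.
set L := expect _ _ _ ul; set S := kernel_small us s; set S' := kernel_small ul s.
rewrite !ler_norml => /andP[? ?] /andP[? ?] /andP[? ?].
by apply/andP; split; lra.
Qed.

End Large.

Lemma tilt_dist : is_dist (tilt p tau).
Proof.
split=> [y|]; first by rewrite divr_ge0 ?mulr_ge0 // ltW.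
by rewrite -mulr_suml mulfV ?gt_eqF.
Qed.

(** * Leaf probability and distance to the target *)

Section Guarantees.
Variables (a : R) (T : nat).
Hypothesis a_ge1 : 1 <= a.
Hypothesis T_ge : 100 * H%:R ^+ 2 * kap ^+ 4 * a * lg (H%:R * kap) <= T%:R.
Local Notation N := (kap * H%:R).
Local Notation small := (vgb_small R A H T).

Let N_ge1 : 1 <= N. Proof. by rewrite mulr_ege1 ?ler1n. Qed.

Let N_gt0 : 0 < N. Proof. exact: lt_le_trans N_ge1. Qed.

Let expRa_le1 : expR (- a) <= 1.
Proof. by rewrite expR_le1 oppr_le0 (le_trans ler01). Qed.

Lemma small_mixing f B : 0 <= B -> tsum H (fun s => dg s * f s) = 0 ->
  (forall s, (size s <= H)%N -> `|f s| <= B) ->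
  `|expect ref V small f| <= B * (expR (- a) / (64 * N)).
Proof.
move=> B0 f0 fB; set eta := _ / (64 * N).
have eta0 : 0 <= eta by rewrite divr_ge0 ?expR_ge0 // mulr_ge0 // ltW.
rewrite -ler_sqr ?nnegrE ?(mulr_ge0 B0 eta0) // real_normK ?num_real //.
apply: le_trans (expect_lazy_walk_small_root T f0 fB) _.
rewrite exprMn mulrA mulrC ler_wpM2l ?sqr_ge0 //.
exact: mixing_time.
Qed.

(** Not automatic, since a draw from weights that all vanish has expectation 0; from the root the
    exact walk never meets such a node. *)
Lemma small_cst c : expect ref V small (fun=> c) = c.
Proof.
rewrite /vgb_small expect_lazy_walk_small.
suff E t s : (size s <= H)%N -> 0 < v s -> lazy_iter kernel_small t (fun=> c) s = c.
  by apply: E => //; apply: tilted_mass_root_gt0.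
elim: t s => // t IH s sH vs /=; rewrite /lazy_step IH //.
suff -> : kernel_small (lazy_iter kernel_small t (fun=> c)) s = c by field.
rewrite -[RHS](kernel_small_cst c sH vs); apply/eqP; rewrite -subr_eq0 -normr_le0.
have -> : forall g, kernel_small g s - kernel_small (fun=> c) s =
    kernel_small (fun n => g n + -1 * c) s.
  by move=> g; rewrite /kernel_small expectD expectZ mulN1r.
by apply: kernel_small_norm => // n nH vn; rewrite IH // mulN1r subrr normr0.
Qed.

Let D := tsum H dg.
Let Zt := \sum_y p y * tau y.

Lemma tsum_deg_is_leaf : tsum H (fun s => dg s * (is_leaf H s)%:R) = Zt.
Proof.
rewrite tsum_leafE => [|s sH]; last by rewrite /is_leaf ltn_eqF.
by apply: eq_bigr => y _; rewrite /is_leaf size_tuple eqxx mulr1.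
Qed.

Lemma leaf_fraction : (2 * N)^-1 <= Zt / D <= 1.
Proof.
have ZD : Zt <= D.
  rewrite -tsum_deg_is_leaf; apply: ler_tsum => s sH.
  rewrite ler_piMr ?lern1 ?leq_b1 //.
  by apply: deg_ge0 => //; apply: edge_weight_ge0.
have D0 : 0 < D by apply: lt_le_trans Z_gt0 ZD.
have n2 : 0 < 2 * N by rewrite mulr_gt0.
rewrite [Zt / D <= 1]ler_pdivrMr // mul1r ZD andbT ler_pdivlMr // mulrC ler_pdivrMr //.
by rewrite mulrC mulrA; apply: tsum_degE_le.
Qed.

(** Mixing is applied to the indicator of the leaves minus its stationary mean, leaving at least
    [1/2 - 1/64] in units of [N^-1]. *)
Lemma small_is_leaf_ge : (4 * N)^-1 <= Pr ref V small (is_leaf H).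
Proof.
case/andP: leaf_fraction => c2 c1; set c := Zt / D in c1 c2.
have D0 : 0 < D.
  by apply: lt_le_trans (tsum_ge_root (F := dg) _);
    [apply: deg_gt0 => //; apply: tilted_mass_root_gt0 |
     move=> s sH; apply: deg_ge0 => //; apply: edge_weight_ge0].
have c0 : 0 <= c by apply: le_trans c2; rewrite invr_ge0 mulr_ge0 // ltW.
have f0 : tsum H (fun s => dg s * ((is_leaf H s)%:R - c)) = 0.
  rewrite (eq_tsum (G := fun s => dg s * (is_leaf H s)%:R + - c * dg s)).
    rewrite tsumD tsum_deg_is_leaf tsumZ -/D /c mulNr mulfVK ?subrr //.
    exact: lt0r_neq0.
  by move=> s _; ring.
have fB s : (size s <= H)%N -> `|(is_leaf H s)%:R - c| <= 1.
  by move=> _; case: (is_leaf H s); rewrite ler_norml /=; apply/andP; split; lra.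
have := small_mixing ler01 f0 fB; rewrite mul1r.
have -> : expect ref V small (fun s => (is_leaf H s)%:R - c) = Pr ref V small (is_leaf H) - c.
  by rewrite (expectD _ _ _ _ (fun=> - c)) small_cst.
rewrite ler_norml => /andP[lo _].
have e64 : expR (- a) / (64 * N) <= (64 * N)^-1.
  by rewrite ler_piMl // invr_ge0 mulr_ge0 // ltW.
move: lo c2 e64; rewrite !invfM; set n := N^-1; set e := expR _ * _; set x := Pr _ _ _ _.
have : 0 < n by rewrite invr_gt0.
by move=> *; lra.
Qed.

(** The constants match: half of [eps / (4 * N)], divided by a leaf probability of at least
    [(8 * N)^-1], is at most [eps]. *)
Lemma dTV_of_test (P : prog R A (seq A)) eps :
  (8 * N)^-1 <= Pr ref V P (is_leaf H) ->
  (forall f : seq A -> R, tsum H (fun s => dg s * f s) = 0 ->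
     (forall s, `|f s| <= 2) -> `|expect ref V P f| <= eps / (4 * N)) ->
  dTV (@leaf_law R A H ref V P) (tilt p tau) <= eps.
Proof.
move=> L8 Pf; have n8 : 0 < (8 * N)^-1 by rewrite invr_gt0 mulr_gt0.
have L0 := lt_le_trans n8 L8.
have [phi [phi0 phi2 phit ->]] := dTV_leaf_law_test tilt_dist L0.
have f0 : tsum H (fun s => dg s * phi s) = 0.
  rewrite tsum_leafE //; transitivity (Zt * \sum_y tilt p tau y * phi y).
    rewrite mulr_sumr; apply: eq_bigr => y _.
    by rewrite /tilt /Zt; field; rewrite gt_eqF.
  by rewrite phit mulr0.
have le := Pf _ f0 phi2; have n4 : 0 < (4 * N)^-1 by rewrite invr_gt0 mulr_gt0.
have eps0 : 0 <= eps by rewrite -(pmulr_lge0 _ n4) (le_trans _ le).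
rewrite mulrA ler_pdivrMr //.
have : expect ref V P phi <= 2 * eps * (8 * N)^-1.
  apply: le_trans (ler_norm _) (le_trans le _).
  by rewrite le_eqVlt; apply/orP; left; apply/eqP; field; rewrite !gt_eqF ?ltr0n.
have : 2 * eps * (8 * N)^-1 <= 2 * eps * Pr ref V P (is_leaf H).
  by rewrite ler_wpM2l // mulr_ge0.
by move=> *; lra.
Qed.

Lemma small_dTV : dTV (@leaf_law R A H ref V small) (tilt p tau) <= expR (- a).
Proof.
apply: dTV_of_test => [|f f0 f2].
  apply: le_trans small_is_leaf_ge.
  have n c : 0 < c -> c * N \is Num.pos by move=> c0; rewrite posrE mulr_gt0.
  by rewrite lef_pV2 ?n // ler_pM2r // ler_nat.
apply: le_trans (small_mixing _ f0 (fun s _ => f2 s)) _ => //.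
rewrite !invfM !mulrA; have n0 : 0 < N^-1 by rewrite invr_gt0.
have := mulr_ge0 (expR_ge0 (- a)) (ltW n0); rewrite invfM !mulrA.
by move=> *; lra.
Qed.

Section LargeGuarantees.
Variable delta : R.
Hypothesis delta_gt0 : 0 < delta.
Hypothesis T_gt0 : (0 < T)%N.
Local Notation delta' := (delta / (16 * kap * H%:R * T%:R)).
Local Notation large := (vgb_large A H Ca (kap - 1) delta T).

Let delta'E : T%:R * delta' = delta / (16 * N).
Proof.
have t0 : 0 < T%:R :> R by rewrite ltr0n.
by field; rewrite !gt_eqF ?ltr0n.
Qed.

Let vgb_largeE : large = lazy_walk (step_large H (4 * Ca * kap ^+ 2) delta') T [::].
Proof. by rewrite /vgb_large (addrC 1) subrK. Qed.

(** The choice of [delta'] makes the error accumulated over [T] steps independent of [T];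
    [delta <= 1] guarantees [delta' < 4], so that the number of draws is positive. *)
Lemma large_error f B : delta <= 1 -> 0 <= B ->
  (forall s, (size s <= H)%N -> `|f s| <= B) ->
  `|expect ref V large f - expect ref V small f| <= B * (3 * delta / (64 * N)).
Proof.
move=> d1 B0 fB; rewrite vgb_largeE.
have t1 : 1 <= T%:R :> R by rewrite ler1n.
have d4 : 0 < delta' < 4.
  have n1 : 1 <= 16 * kap * H%:R * T%:R.
    by rewrite -[16 * kap * _]mulrA !mulr_ege1 ?ler1n.
  have n0 := lt_le_trans ltr01 n1.
  rewrite divr_gt0 //= ltr_pdivrMr //.
  by lra.
apply: le_trans (lazy_walk_error T d4 B0 _ tilted_mass_root_gt0 fB) _ => //.
have -> : T%:R * (3 / 4 * B * delta') = 3 / 4 * B * (T%:R * delta') by ring.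
by rewrite delta'E le_eqVlt; apply/orP; left; apply/eqP; field; rewrite !gt_eqF ?ltr0n.
Qed.

(** In units of [N^-1], the exact bound 1/4 loses at most 3/64 and stays above 1/8. *)
Lemma large_is_leaf_ge : delta <= 1 -> (8 * N)^-1 <= Pr ref V large (is_leaf H).
Proof.
move=> d1; have lo := small_is_leaf_ge.
have fB s : (size s <= H)%N -> `|(is_leaf H s)%:R : R| <= 1.
  by move=> _; rewrite normr_nat lern1 leq_b1.
have := large_error d1 ler01 fB; rewrite mul1r -!/(Pr _ _ _ _).
rewrite ler_norml => /andP[le _].
have n0 : 0 < N^-1 by rewrite invr_gt0.
have e : 3 * delta / (64 * N) <= 3 / 64 * N^-1.
  by rewrite invfM mulrA; have := ler_wpM2r (ltW n0) d1; lra.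
move: lo le e; rewrite /Pr (invfM 4 N) (invfM 8 N); move: (N^-1) n0 => n n0.
by move=> *; lra.
Qed.

(** For [delta > 1] the bound is trivial. Otherwise the sampling and mixing errors add up to at most
    [8/64] of [delta / N], below the allowed [1/4]. *)
Lemma large_dTV : expR (- a) <= delta ->
  dTV (@leaf_law R A H ref V large) (tilt p tau) <= delta.
Proof.
move=> ad; have [d1|/ltW d1] := leP delta 1; last first.
  apply: le_trans d1; apply: dTV_leaf_law_le1; first exact: tilt_dist.
  by move=> y; rewrite vgb_largeE; apply: lazy_walk_large_ge0 => // s; apply: ler0n.
apply: dTV_of_test => [|f f0 f2]; first exact: large_is_leaf_ge.
have e1 := large_error d1 (ler0n _ 2) (fun s _ => f2 s).
have e2 := small_mixing (ler0n _ 2) f0 (fun s _ => f2 s).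
have n0 : 0 < N^-1 by rewrite invr_gt0.
rewrite -[expect _ _ large f](subrK (expect ref V small f)).
apply: le_trans (ler_normD _ _) (le_trans (lerD e1 e2) _).
have := ler_wpM2r (ltW n0) ad; have := mulr_gt0 delta_gt0 n0.
have -> : 2 * (3 * delta / (64 * N)) + 2 * (expR (- a) / (64 * N)) =
  6 / 64 * (delta * N^-1) + 2 / 64 * (expR (- a) * N^-1) by field; rewrite !gt_eqF ?ltr0n.
have -> : delta / (4 * N) = 4^-1 * (delta * N^-1) by field; rewrite !gt_eqF ?ltr0n.
by move=> *; lra.
Qed.

End LargeGuarantees.
End Guarantees.
End ModelWalk.

Theorem theorem4p1 :
  exists C k Csmall Clarge klarge : nat,
  forall (R : realType) (A : finType) (H : nat) (X : Type)
    (piref : X -> H.-tuple A -> R) (tau : X -> H.-tuple A -> R)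
    (Vhat : X -> seq A -> R) (epsV delta : R) (x : X),
  (1 <= H)%N ->
  (forall x', is_dist (piref x')) ->
  (forall x' y, 0 <= tau x' y) ->
  (forall x', 0 < \sum_(y : H.-tuple A) piref x' y * tau x' y) ->
  (forall x' (s : seq A), (size s <= H)%N -> 0 <= Vhat x' s) ->
  0 <= epsV ->
  0 < delta ->
  (forall y : H.-tuple A, Vhat x y = tau x y) ->
  (forall s : seq A, (1 <= size s < H)%N -> 0 < pmass (piref x) s ->
     Vstar (piref x) (tau x) s / (1 + epsV) <= Vhat x s
       <= (1 + epsV) * Vstar (piref x) (tau x) s) ->
  let T := vgb_steps C k H epsV delta in
  let Ca := Cact (piref x) (tau x) in
  let ref := pnext (piref x) in
  let small := vgb_small R A H T in
  let large := vgb_large A H Ca epsV delta T in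
  let target := tilt (piref x) (tau x) in
  [/\ Pr ref (Vhat x) small (is_leaf H) >= (8 * (1 + epsV) * H%:R)^-1,
      dTV (@leaf_law R A H ref (Vhat x) small) target <= delta &
      (cost ref (Vhat x) small <= Csmall * #|A| * T)%N] /\
  [/\ delta <= 1 ->
        Pr ref (Vhat x) large (is_leaf H) >= (8 * (1 + epsV) * H%:R)^-1,
      dTV (@leaf_law R A H ref (Vhat x) large) target <= delta &
      (cost ref (Vhat x) large)%:R <=
        Clarge%:R * Ca * (1 + epsV) ^+ 2
          * lg ((1 + epsV) * H%:R * T%:R / delta) ^+ klarge * T%:R].
Proof.
(* 100 and the single logarithm come from the mixing time, [8 = 7 + 1] counts the lazy coin, and
   [1247 = 11 * 113 + 4]. *)
exists 100%N, 1%N, 8%N, 1247%N, 1%N.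
move=> R A H X piref tau Vhat epsV delta x H0 pd t0 Z0 V0 e0 d0 Vl Vr.
move=> T Ca ref small large target.
have k1 : 1 <= 1 + epsV by rewrite lerDl.
have kE : 1 + epsV - 1 = epsV by rewrite addrAC subrr add0r.
have a1 : 1 <= lg delta^-1 by apply: lg_ge1.
have ad := expR_Nlg_le d0.
have h1 : 1 <= H%:R :> R by rewrite ler1n.
have hT : 100 * H%:R ^+ 2 * (1 + epsV) ^+ 4 * lg delta^-1 *
    lg (H%:R * (1 + epsV)) <= T%:R.
  by have := vgb_steps_ge 100 1 H epsV delta; rewrite expr1.
have T0 : (0 < T)%N.
  rewrite -(ler1n R); apply: le_trans hT.
  by rewrite !mulr_ege1 ?exprn_ege1 ?lg_ge1 ?ler1n.
(* With no action there would be no response of positive length, and the normalizing constant would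
   be 0. *)
have A0 : (0 < #|A|)%N.
  rewrite lt0n; apply/eqP => A0; have := Z0 x; rewrite big_pred0 ?ltxx // => y.
  by case: H y H0 {piref tau pd t0 Z0 Vl Vr T Ca ref small large target hT T0 V0 h1}
    => // n y _; case: (fintype0 (thead y) A0).
split; split.
- apply: le_trans (small_is_leaf_ge H0 (pd x) (t0 x) (Z0 x) (V0 x) k1 Vl Vr a1 hT).
  have n0 : 0 < (1 + epsV) * H%:R by rewrite mulr_gt0 // (lt_le_trans ltr01).
  have n c : 0 < c -> c * ((1 + epsV) * H%:R) \is Num.pos.
    by move=> c0; rewrite posrE mulr_gt0.
  by rewrite -mulrA lef_pV2 ?n // ler_pM2r // ler_nat.
- exact: le_trans (small_dTV H0 (pd x) (t0 x) (Z0 x) (V0 x) k1 Vl Vr a1 hT) ad.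
- apply: leq_trans (cost_lazy_walk T [::] (fun z => cost_step_small H _ _ z A0)) _.
  by rewrite leq_mul2r; apply/orP; right; lia.
- move=> d1.
  have := large_is_leaf_ge H0 (pd x) (t0 x) (Z0 x) (V0 x) k1 Vl Vr a1 hT d0 T0 d1.
  by rewrite kE mulrA.
- have := large_dTV H0 (pd x) (t0 x) (Z0 x) (V0 x) k1 Vl Vr a1 hT d0 T0 ad.
  by rewrite kE.
have Ca1 : 1 <= Ca by apply: Cact_ge1.
set c := Ca * (1 + epsV) ^+ 2.
have c1 : 1 <= c by rewrite mulr_ege1 ?exprn_ege1.
set N := (1 + epsV) * H%:R * T%:R.
have N1 : 1 <= N by rewrite !mulr_ege1 ?ler1n.
have draws := natceil_draws_le c1 d0 N1.
set n := natceil _ in draws.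
have cost_le : (cost ref (Vhat x) large <= (11 * n + 3).+1 * T)%N.
  apply: cost_lazy_walk => z; apply: leq_trans (cost_step_large _ _ _ _ _ _) _.
  have -> : 4 * Ca * (1 + epsV) ^+ 2 = 4 * c by rewrite /c mulrA.
  by have -> : 16 * (1 + epsV) * H%:R * T%:R = 16 * N by rewrite /N !mulrA.
apply: (@le_trans _ _ ((11 * n + 3).+1 * T)%:R); first by rewrite ler_nat.
have -> : 1247%:R * Ca * (1 + epsV) ^+ 2 * lg (N / delta) ^+ 1 =
   1247 * (c * lg (N / delta)) by rewrite /c; ring.
rewrite natrM ler_wpM2r ?ler0n // -natr1 natrD natrM.
have := mulr_ege1 c1 (lg_ge1 (N / delta)).
move: draws; rewrite -mulrA; set L := c * _ => draws L1.
by lra.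
Qed.
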